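(* Let $(\mathcal X,\rho_{\mathcal X})$ be a separable metric space and let $\mathcal Y$ be a separable Banach space with norm metric $\rho_{\mathcal Y}$, both with their Borel $\sigma$-algebras. Let $(X,Y)$ be a random pair with values in $\mathcal X\times\mathcal Y$, and let $\mathcal S$ be the support of the distribution $\mu_Y$ of $Y$. Let $\ell:\mathcal Y\times\mathcal Y\to[0,\infty)$ be a measurable loss function for which there are finite constants $L$ and $c$ and a constant $\alpha>0$ such that for all $y,y',y''\in\mathcal Y$, $$\ell(y,y')\le L,\qquad |\ell(y,y')-\ell(y,y'')|\le c\,\ell(y',y''),\qquad \ell(y,y')\le\rho_{\mathcal Y}(y,y')^{\alpha}.$$ For measurable $m:\mathcal X\to\mathcal Y$ put $R(m)=\mathbb E[\ell(Y,m(X))]$. Assume there is a measurable function $m_{Fr}:\mathcal X\to\mathcal Y$ (conditional Fréchet mean) with $$m_{Fr}(x)\in\arg\min_{y\in\mathcal Y}\mathbb E[\ell(Y,y)\mid X=x]\quad\text{for all }x\in\mathcal X,$$ and that $m_{Fr}(x)\in\mathcal S$ for all $x\in\mathcal X$. Let $(X_1,Y_1),(X_2,Y_2),\dots$ be i.i.d. copies of $(X,Y)$, let $X'_1,X'_2,\dots$ be i.i.d. copies of $X$ and $Y'_1,Y'_2,\dots$ be i.i.d. copies of $Y$, the prototypes $(X'_i)_{i\ge1},(Y'_i)_{i\ge 1}$ being jointly independent of the sequence $((X_i,Y_i))_{i\ge1}$. Assume that ties occur with probability zero for the prototypes $X'_i$. For $k\ge1$ let $A_{k,1},\dots,A_{k,k}$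 be the Voronoi partition of $\mathcal X$ with nuclei $X'_1,\dots,X'_k$. Let $(k_n)$ be a sequence of positive integers with $k_n\to\infty$ and $k_n\ln n/n\to0$, and define, with $k=k_n$, $$m_n(x)\in\arg\min_{y\in\{Y'_1,\dots,Y'_n\}}\ \sum_{i=1}^n\ell(Y_i,y)\,\mathbb I_{\{X_i\in A_{k,j}\}}\qquad\text{for } x\in A_{k,j},\ j=1,\dots,k,$$ where the selected minimizer is the same for all $x$ in the same cell $A_{k,j}$. Then $$\lim_{n\to\infty}R(m_n)=R(m_{Fr})\quad\text{almost surely.}$$
   Context: The support $\mathcal S$ of $\mu_Y$ is the set of points $y\in\mathcal Y$ all of whose open neighbourhoods have positive $\mu_Y$-measure. The conditional expectations $\mathbb E[\ell(Y,y)\mid X=x]$ are computed with a fixed regular conditional distribution of $Y$ given $X$. Voronoi partition: $A_{k,j}=\{x\in\mathcal X: j=\arg\min_{1\le i\le k}\rho_{\mathcal X}(x,X'_i)\}$, with ties broken by indices: if $X'_i$ and $X'_j$ are equidistant from $x$, then $X'_i$ is declared closer if $i<j$. ''Ties occur with probability zero'' means that for $i\ne j$, $\mathbb P\{\rho_{\mathcal X}(X,X'_i)=\rho_{\mathcal X}(X,X'_j)\}=0$, where $X$ is independent of the prototypes. The minimizers need not be unique; $m_{Fr}(x)$ and the values of $m_n$ are arbitrary measurable selections among the minimizers. $\mathbb I$ denotes the indicator. $R(m_n)$ denotes the functional $R$ evaluated at the random function $m_n$, i.e. $R(m_n)=\mathbb E[\ell(Y,m_n(X))\mid \text{all data and prototypes}]$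 with $(X,Y)$ a fresh pair independent of the data and prototypes. *)

(* Defs.v *)
(* MathComp-Analysis *)
From HB Require Import structures.
From mathcomp Require Import all_boot all_order all_algebra finmap.
From mathcomp Require Import all_classical all_reals all_analysis.

Set Implicit Arguments.
Unset Strict Implicit.
Unset Printing Implicit Defensive.

Import Order.TTheory GRing.Theory Num.Theory.
Import numFieldNormedType.Exports.

Local Open Scope classical_set_scope.
Local Open Scope ring_scope.

(* [measurableType] extends [pointedType], so the Borel structure below needs
   a metric space with a chosen point; this only excludes the empty space, in
   which no random variable takes values. *)
#[short(type="pmetricType")]
HB.structure Definition PointedMetric (K : numDomainType) :=
  { M of Metric K M & Pointed M }.

Definition separable (T : topologicalType) :=
  exists2 D : set T, countable D & dense D.

(* An alias of [T] that carries the Borel sigma-algebra; [borel T * borel U]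
   carries the product sigma-algebra, which for separable metric spaces is the
   Borel sigma-algebra of the product. *)
Notation borel T := (g_sigma_algebraType (@open T)).

Definition measure_support (T : topologicalType) (R : realType)
    (mu : set T -> \bar R) : set T :=
  [set y | forall U : set T, open U -> U y -> (0 < mu U)%E].

Definition argmin (T : Type) (d : Order.disp_t) (V : porderType d)
    (A : set T) (f : T -> V) : set T :=
  [set x | A x /\ forall y, A y -> (f x <= f y)%O].

Section probability.
Context (d dT dU : measure_display) (Omega : measurableType d)
  (T : measurableType dT) (U : measurableType dU) (R : realType)
  (P : probability Omega R).

Definition same_law (Z W : Omega -> T) :=
  forall A, measurable A -> P (Z @^-1` A) = P (W @^-1` A).

Definition mutually_independent (Z : nat -> Omega -> T) :=
  forall (J : {fset nat}) (A : nat -> set T), (forall i, measurable (A i)) ->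
    P (\bigcap_(i in [set` J]) Z i @^-1` A i) =
    (\prod_(i <- J) P (Z i @^-1` A i))%E.

Definition iid_copies (Z : nat -> Omega -> T) (Z0 : Omega -> T) :=
  mutually_independent Z /\ forall i, same_law (Z i) Z0.

Definition sigma_generated (V : Type) (G : set (set V)) (Z : nat -> Omega -> V)
    : set (set Omega) :=
  <<s [set B | exists i, exists2 A, G A & B = Z i @^-1` A] >>.

Definition independent_sequences (Z : nat -> Omega -> T)
    (W : nat -> Omega -> U) :=
  forall A B, sigma_generated measurable Z A ->
    sigma_generated measurable W B -> P (A `&` B) = (P A * P B)%E.

Definition regular_conditional_distribution (X : Omega -> T) (Y : Omega -> U)
    (kappa : R.-pker T ~> U) :=
  forall A B, measurable A -> measurable B ->
    P (X @^-1` A `&` Y @^-1` B) =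
    (\int[P]_(w in X @^-1` A) kappa (X w) B)%E.

Definition risk (X : Omega -> T) (Y : Omega -> U) (l : U -> U -> R)
    (m : T -> U) : \bar R :=
  ('E_P[fun w => l (Y w) (m (X w))])%E.

End probability.

Section voronoi.
Context (R : realType) (T : metricType R).

(* The nucleus [c i] is declared closer to [x] than [c j]. *)
Definition closer (c : nat -> T) (x : T) (i j : nat) :=
  (mdist x (c i) < mdist x (c j)) ||
  ((mdist x (c i) == mdist x (c j)) && (i < j)%N).

(* Nuclei are numbered from 0, so the cells of the partition with [k] nuclei
   are [voronoi c k j] for [j < k]. *)
Definition voronoi (c : nat -> T) (k j : nat) : set T :=
  [set x | forall i, (i < k)%N -> i != j -> closer c x j i].

End voronoi.

(* Main.v *)
Require Import Defs.
From HB Require Import structures.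
From mathcomp Require Import all_boot all_order all_algebra finmap.
From mathcomp Require Import all_classical all_reals all_analysis.
From mathcomp Require Import measurable_realfun ring lra.

Set Implicit Arguments.
Unset Strict Implicit.
Unset Printing Implicit Defensive.

Import Order.TTheory GRing.Theory Num.Theory.
Import numFieldNormedType.Exports.

Local Open Scope classical_set_scope.
Local Open Scope ring_scope.

(* Empirical risk minimization over the functions that are constant on the
   Voronoi cells with values in {Y'_1, ..., Y'_n}.
   Estimation error: given the prototypes there are only n^(k_n) such
   functions, so an exponential deviation inequality for the empirical risk of
   each of them, a union bound, k_n ln n / n -> 0 and Borel-Cantelli show that
   the empirical risks converge to the risks uniformly, almost surely.
   Approximation error: on a set of large measure, m_Fr maps points at distance
   less than some r > 0 into a common ball among finitely many small balls.
   Almost surely the nuclei X'_j eventually meet every ball of positive measure,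
   hence most points are close to the nucleus of their cell, and so are the
   other points of the same cell; the points Y'_i eventually meet every ball
   that meets the support. So one of the candidate functions is close to m_Fr
   in measure, and the loss is bounded and Hoelder.
   That m_Fr is optimal follows by disintegration. *)

(** * Concentration of sums of independent variables *)

Lemma normr_sub_le_bound (R : realDomainType) (a b L : R) :
  0 <= a <= L -> 0 <= b <= L -> `|a - b| <= `|L| + 1.
Proof. by move=> ? ?; have := ler_norm L; rewrite ler_norml; lra. Qed.

Lemma measurable_set_ler d (T : measurableType d) (R : realType) (f g : T ->
  R) :
  measurable_fun [set: T] f -> measurable_fun [set: T] g ->
  measurable [set x | f x <= g x].
Proof.
move=> mf mg; rewrite [X in measurable X](_ : _ =
    setT `&` (fun x => f x <= g x) @^-1` [set true]).
  exact: (measurable_fun_ler mf mg measurableT).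
by rewrite setTI; apply/seteqP; split=> x.
Qed.

(** * From indicators to nonnegative measurable functions *)

Section ge0_measurable_ind.
Local Open Scope ereal_scope.
Context d (T : measurableType d) (R : realType).
Variable Q : (T -> \bar R) -> Prop.
Hypothesis Qindic : forall A, measurable A -> Q (EFin \o \1_A).
Hypothesis QZ : forall (r : R) (f : T -> \bar R), (0 <= r)%R ->
  measurable_fun [set: T] f ->
  (forall x, 0 <= f x) -> Q f -> Q (fun x => r%:E * f x).
Hypothesis QD : forall f g : T -> \bar R, measurable_fun [set: T] f ->
  (forall x, 0 <= f x) ->
  measurable_fun [set: T] g -> (forall x, 0 <= g x) ->
  Q f -> Q g -> Q (fun x => f x + g x).
Hypothesis Qlim : forall f_ : (T -> \bar R)^nat,
  (forall n, measurable_fun [set: T] (f_ n)) -> (forall n x, 0 <= f_ n x) ->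
  (forall x, {homo f_ ^~ x : n m / (n <= m)%N >-> n <= m}) ->
  (forall n, Q (f_ n)) -> Q (fun x => limn (f_ ^~ x)).

Import HBNNSimple.

(** The increasing simple approximations of [f] are finite sums of nonnegative multiples of
    indicators of level sets, so closure under scaling, sums and monotone limits reaches [f]. *)
Lemma ge0_measurable_ind (f : T -> \bar R) : measurable_fun [set: T] f ->
  (forall x, 0 <= f x) ->
  Q f.
Proof.
move=> mf f0; pose g := nnsfun_approx measurableT mf.
have -> : f = fun x => limn (fun n => (g n x)%:E).
  by apply/funext => x; apply/esym/cvg_lim => //; exact: cvg_nnsfun_approx.
apply: Qlim => [n|n x|x n p np|n].
- exact/measurable_EFinP.
- by rewrite lee_fin.
- by rewrite lee_fin; exact/lefP/nd_nnsfun_approx.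
have -> : (fun x => (g n x)%:E) = fun x => \sum_(r <- fset_set (range (g n)))
    (r%:E * (\1_(g n @^-1` [set r]) x)%:E).
  by apply/funext => x; rewrite fimfunE fsbig_finite//= -sumEFin.
have : forall r, r \in (fset_set (range (g n)) : seq R) -> (0 <= r)%R.
  by move=> r; rewrite in_fset_set// inE => -[x _ <-].
elim: (fset_set (range (g n)) : seq R) => [_|r s IHs rs].
  have := @Qindic set0 measurable0; congr Q.
  by apply/funext => x/=; rewrite big_nil indic0.
have m1 r' : measurable_fun [set: T] (EFin \o (\1_(g n @^-1` [set r']) : T ->
  R)).
  by apply/measurable_EFinP; exact: measurable_indic.
have -> : (fun x => \sum_(i <- r :: s) (i%:E * (\1_(g n @^-1` [set i]) x)%:E)) =
   fun x => r%:E * (\1_(g n @^-1` [set r]) x)%:E +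
            \sum_(i <- s) (i%:E * (\1_(g n @^-1` [set i]) x)%:E).
  by apply/funext => x; rewrite big_cons.
have r0 : (0 <= r)%R by exact: (rs r (mem_head r s)).
have s0 i : i \in s -> (0 <= i)%R.
  by move=> si; apply: rs; rewrite inE si orbT.
apply: QD.
- exact: (measurable_funeM r%:E (m1 r)).
- by move=> x; rewrite -EFinM lee_fin mulr_ge0.
- by apply: emeasurable_sum => i; exact: (measurable_funeM i%:E (m1 i)).
- move=> x; rewrite big_seq; apply: sume_ge0 => i si.
  by rewrite -EFinM lee_fin mulr_ge0// s0.
- apply: (@QZ r (EFin \o \1_(g n @^-1` [set r]))) => //.
  + by move=> x; rewrite lee_fin.
  + exact: Qindic.
- exact: IHs.
Qed.

End ge0_measurable_ind.

Section independence.
Local Open Scope ereal_scope.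
Context d dT (Omega : measurableType d) (T : measurableType dT) (R : realType)
  (P : probability Omega R).

Lemma integral_probability_cst (r : R) : \int[P]_w r%:E = r%:E.
Proof.
rewrite integral_cst//= -[in RHS](mule1 r%:E); congr (_ * _).
exact: probability_setT.
Qed.

(** Both sides are additive, homogeneous and continuous along increasing sequences in [f], so
    indicators suffice. This serves to replace one indicator factor of a product by a general one,
    [G] being the product of the other factors. *)
Lemma integral_comp_mul_cst (Z : Omega -> T) (G : Omega -> R) (C : R) :
  measurable_fun [set: Omega] Z -> measurable_fun [set: Omega] G -> (forall w,
    0 <= G w)%R ->
  (0 <= C)%R ->
  (forall A, measurable A ->
    \int[P]_w ((\1_A (Z w))%:E * (G w)%:E) = P (Z @^-1` A) * C%:E) ->
  forall f : T -> \bar R, measurable_fun [set: T] f -> (forall x, 0 <= f x) ->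
  \int[P]_w (f (Z w) * (G w)%:E) = \int[P]_w f (Z w) * C%:E.
Proof.
move=> mZ mG G0 C0 H; have mGE : measurable_fun [set: Omega] (EFin \o G).
  exact/measurable_EFinP.
have mfZ (f : T -> \bar R) : measurable_fun [set: T] f ->
  measurable_fun [set: Omega] (fun w => f (Z w)) by move=> mf; exact:
    measurableT_comp.
have mfG (f : T -> \bar R) : measurable_fun [set: T] f ->
    measurable_fun [set: Omega] (fun w => f (Z w) * (G w)%:E).
  by move=> mf; apply: emeasurable_funM => //; exact: mfZ.
have fG0 (f : T -> \bar R) : (forall x, 0 <= f x) ->
    forall w, 0 <= f (Z w) * (G w)%:E.
  by move=> f0 w; rewrite mule_ge0// lee_fin.
apply: ge0_measurable_ind => [A mA|r f r0 mf f0 Qf|f g mf f0 mg g0 Qf Qg|].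
- rewrite /= H//; congr (_ * _).
  rewrite -[in LHS](setIT (Z @^-1` A)) -integral_indic//.
  by rewrite -[_ @^-1` _]setTI; exact: mZ.
- under eq_integral do rewrite -muleA.
  rewrite ge0_integralZl//; [|exact: mfG|by move=> w _; exact: fG0].
  by rewrite Qf ge0_integralZl ?muleA//; exact: mfZ.
- under eq_integral do rewrite ge0_muleDl//.
  rewrite ge0_integralD//; [|by move=> w _; exact: fG0|exact: mfG|
    by move=> w _; exact: fG0|exact: mfG].
  rewrite Qf Qg [X in _ = X * _]ge0_integralD//; [|exact: mfZ|exact: mfZ].
  have If : 0 <= \int[P]_w f (Z w) by apply: integral_ge0 => w _.
  have Ig : 0 <= \int[P]_w g (Z w) by apply: integral_ge0 => w _.
  by rewrite (ge0_muleDl _ If Ig).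
move=> f_ mf_ f_0 ndf_ Qf_.
have cf x : cvgn (f_ ^~ x) by exact/ereal_nondecreasing_is_cvgn/ndf_.
under eq_integral => w _.
  rewrite -(@cvg_lim _ _ _ _ _ _ _ (cvgeZr (isT :
    (G w)%:E \is a fin_num) (cf (Z w))))//.
  over.
rewrite monotone_convergence//; last 3 first.
  by move=> n; exact: mfG.
  by move=> n w _; exact: fG0.
  by move=> w _ n m nm; apply: lee_wpmul2r; [rewrite lee_fin|exact: ndf_].
rewrite monotone_convergence//; last by move=> n; exact: mfZ.
under eq_fun do rewrite Qf_.
apply/cvg_lim => //; apply: cvgeZr => //.
apply: ereal_nondecreasing_is_cvgn => n m nm.
apply: ge0_le_integral => //; [exact: mfZ|exact: mfZ|].
by move=> w _; exact: ndf_.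
Qed.

Lemma independent_bigcap (Z : nat -> Omega -> T) (A : (set T)^nat) (n : nat) :
  mutually_independent P Z -> (forall i, measurable (A i)) ->
  P (\bigcap_(i < n) Z i @^-1` A i) = \prod_(i < n) P (Z i @^-1` A i).
Proof.
move=> indep mA; pose J := [fset i in iota 0 n]%fset.
have JE : perm_eq J (iota 0 n).
  by apply: uniq_perm; [exact: fset_uniq|exact: iota_uniq|move=> i;
    rewrite !inE].
have := indep J A mA.
rewrite (perm_big _ JE)/= -[X in \big[_/_]_(i <- iota 0 X) _]subn0 -/(index_iota
  0 n).
rewrite big_mkord => <-; congr (P _).
by apply: eq_bigcapl; split=> i /=; rewrite !inE mem_iota add0n.
Qed.

Lemma expectation_prod_independent (Z : nat -> Omega -> T) (n : nat) (f : nat ->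
  T -> R) :
  (forall i, measurable_fun [set: Omega] (Z i)) ->
  mutually_independent P Z ->
  (forall i, measurable_fun [set: T] (f i)) -> (forall i x, 0 <= f i x)%R ->
  (forall i, \int[P]_w (f i (Z i w))%:E < +oo) ->
  \int[P]_w (\prod_(i < n) f i (Z i w))%:E =
  \prod_(i < n) \int[P]_w (f i (Z i w))%:E.
Proof.
move=> mZ indep mf0 f00 fy0.
(* Induction on [p], the number of leading factors allowed to be arbitrary; the factors from [p] on
   are indicators. For [p = 0] this is the definition of independence, and [p = n] leaves no
   restriction. *)
suff: forall p (f : nat -> T -> R),
  (forall i, measurable_fun [set: T] (f i)) -> (forall i x, 0 <= f i x)%R ->
  (forall i, \int[P]_w (f i (Z i w))%:E < +oo) ->
  (forall i, (p <= i < n)%N -> exists2 A, measurable A & f i = \1_A) ->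
  \int[P]_w (\prod_(i < n) f i (Z i w))%:E =
  \prod_(i < n) \int[P]_w (f i (Z i w))%:E.
  by move=> /(_ n); apply => // i; rewrite ltnNge andbN.
elim=> [|p IHp] {mf0 f00 fy0}f mf f0 fy fi.
  have /choice[A Af] : forall i : nat, exists A,
      measurable A /\ ((i < n)%N -> f i = \1_A).
    move=> i; have [ni|ni] := ltnP i n; last by exists set0.
    by have [A mA fA] := fi _ ni; exists A.
  have mA i : measurable (A i) by have [] := Af i.
  have fA (i : 'I_n) : f i = \1_(A i) by have [_ ->] := Af i.
  have PA (i : 'I_n) : \int[P]_w (f i (Z i w))%:E = P (Z i @^-1` A i).
    rewrite fA -[in RHS](setIT (Z i @^-1` _)) -integral_indic//.
    by rewrite -[_ @^-1` _]setTI; exact: mZ.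
  under [RHS]eq_bigr do rewrite PA.
  rewrite -independent_bigcap// -[X in P X]setIT -integral_indic//; last first.
    apply: bigcap_measurableType => i _.
    by rewrite -[_ @^-1` _]setTI; exact: mZ.
  apply: eq_integral => w _; congr EFin.
  under eq_bigr do rewrite fA indicE.
  rewrite indicE; have [/set_mem Jw|Jw] := boolP (w \in \bigcap_(i < n) Z i
    @^-1` A i).
    by rewrite big1// => i _; rewrite mem_set//; exact: (Jw i (ltn_ord i)).
  apply/eqP/prodf_eq0; apply: contrapT => H; move/negP: Jw; apply.
  rewrite inE => i/= ni; apply: contrapT => Awi; apply: H.
  by exists (Ordinal ni) => //=; rewrite memNset.
have [pn|np] := ltnP p n; last first.
  apply: IHp => // i /andP[pi ni].
  by have := leq_trans ni np; rewrite ltnNge pi.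
pose q := Ordinal pn.
have intG0 i : 0 <= \int[P]_w (f i (Z i w))%:E.
  by apply: integral_ge0 => w _; rewrite lee_fin.
have fin i : \int[P]_w (f i (Z i w))%:E \is a fin_num.
  by rewrite ge0_fin_numE.
pose C := (\prod_(i < n | i != q) fine (\int[P]_w (f i (Z i w))%:E))%R.
have CE : \prod_(i < n | i != q) \int[P]_w (f i (Z i w))%:E = C%:E.
  by rewrite /C -prodEFin; apply: eq_bigr => i _; rewrite fineK.
rewrite [RHS](bigD1 q)//= CE.
under eq_integral do rewrite (bigD1 q)//= EFinM.
apply: (@integral_comp_mul_cst (Z p) (fun w =>
  \prod_(i < n | i != q) f i (Z i w))%R
   C _ _ _ _ _ (EFin \o f p)) => //.
- apply: (eq_measurable_fun (fun w => \prod_(i < n)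
      if i != q then f i (Z i w) else 1)%R).
    by move=> w _; rewrite [RHS]big_mkcond.
  apply: (@measurable_prod _ _ _ _ _ _
    (fun i w => if i != q then f i (Z i w) else 1)%R) => i _.
  by case: (i != q); [exact: measurableT_comp|exact: measurable_cst].
- by move=> w; apply: prodr_ge0.
- by apply: prodr_ge0 => i _; rewrite fine_ge0.
- move=> A mA.
  (* With an indicator in place of factor [p], only the first [p] factors are arbitrary and the
     induction hypothesis applies. *)
  pose g i := if i == p then \1_A else f i.
  have gE (i : 'I_n) : i != q -> g i = f i by rewrite -val_eqE /g /= =>
    /negbTE ->.
  have gp : g p = \1_A by rewrite /g eqxx.
  have mZA : measurable (Z p @^-1` A) by rewrite -[_ @^-1` _]setTI; exact: mZ.
  have := IHp g.
  rewrite [RHS](bigD1 q)//= gp.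
  under eq_integral do rewrite (bigD1 q)//= EFinM gp.
  under [X in _ * X]eq_bigr => i iq do rewrite gE//.
  under eq_integral => w _. under eq_bigr => i iq do rewrite gE//. over.
  rewrite CE => ->.
  + congr (_ * _); rewrite -[in RHS](setIT (Z p @^-1` _)) -integral_indic//.
  + move=> i; rewrite /g; case: ifPn => // _; exact: measurable_indic.
  + by move=> i x; rewrite /g; case: ifPn.
  + move=> i; rewrite /g; case: ifPn => // _.
    apply: (@le_lt_trans _ _ (\int[P]_w (cst 1 w))).
      apply: ge0_le_integral => //.
      * apply/measurable_EFinP; apply: measurableT_comp => //.
      * by move=> w _; rewrite lee_fin indicE; case: (_ \in _).
    by rewrite integral_cst// mul1e (le_lt_trans (probability_le1 _ _))// ltry.
  + move=> i /andP[pi ni]; rewrite /g; case: ifPn => [_|ip]; first by exists A.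
    by apply: fi; rewrite ni andbT ltn_neqAle eq_sym ip.
- exact/measurable_EFinP.
- by move=> x; rewrite lee_fin.
Qed.

Lemma integral_same_law (Z W : Omega -> T) (f : T -> \bar R) :
  measurable_fun [set: Omega] Z -> measurable_fun [set: Omega] W ->
  same_law P Z W -> measurable_fun [set: T] f -> (forall x, 0 <= f x) ->
  \int[P]_w f (Z w) = \int[P]_w f (W w).
Proof.
move=> mZ mW ZW mf f0.
have := @ge0_integral_pushforward _ _ _ _ _ _ mZ P setT f measurableT mf (fun y
  _ => f0 y).
rewrite preimage_setT => <-.
have := @ge0_integral_pushforward _ _ _ _ _ _ mW P setT f measurableT mf (fun y
  _ => f0 y).
rewrite preimage_setT => <-.
by apply: eq_measure_integral => A mA _; exact: ZW.
Qed.

Lemma bounded_measurable_integrable (h : Omega -> R) (B : R) :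
  measurable_fun [set: Omega] h -> (forall w, `|h w| <= B)%R ->
  P.-integrable setT (EFin \o h).
Proof.
move=> mh hB; apply: measurable_bounded_integrable => //.
  by rewrite (le_lt_trans (probability_le1 _ _))// ltry.
exists B; split; first exact: num_real.
by move=> x Bx w _; exact: le_trans (ltW Bx).
Qed.

(** Since exp(-t) >= 1 - t, exp(t) is at most 1/(1 - t), and (1 - t)(1 + t + 2t^2) = 1 + t^2(1 - 2t)
    is at least 1 for t <= 1/2. *)
Lemma expR_le_quadratic (t : R) : (t <= 2^-1 -> expR t <= 1 + t + 2 * t ^+ 2)%R.
Proof.
move=> t2; have t1 : (0 < 1 - t)%R by lra.
rewrite -[t in expR t]opprK expRN.
have h : ((expR (- t))^-1 <= (1 - t)^-1)%R.
  by rewrite lef_pV2 ?posrE ?expR_gt0//; exact: expR_ge1Dx.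
apply: (le_trans h); rewrite -div1r ler_pdivrMr//.
have : (0 <= t ^+ 2 * (1 - 2 * t))%R by rewrite mulr_ge0 ?sqr_ge0//; lra.
by rewrite !expr2; nra.
Qed.

(** Exponential moments: as [h] is centred under the law of [Z0], the quadratic bound on the
    exponential gives each exp(lam h(Z_i)) an expectation of at most 1 + 2(lam B)^2, hence at most
    exp(2(lam B)^2). Independence multiplies these bounds. The quadratic bound is where lam B <= 1/2
    enters. *)
Lemma chernoff_iid (Z : nat -> Omega -> T) (Z0 : Omega -> T) (h : T -> R)
    (B lam eps : R) (n : nat) :
  (forall i, measurable_fun [set: Omega] (Z i)) ->
  measurable_fun [set: Omega] Z0 ->
  iid_copies P Z Z0 -> measurable_fun [set: T] h ->
  (forall x, `|h x| <= B)%R -> \int[P]_w (h (Z0 w))%:E = 0 ->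
  (0 <= lam)%R -> (lam * B <= 2^-1)%R ->
  P [set w | n%:R * eps <= \sum_(i < n) h (Z i w)]%R <=
    (expR (n%:R * (2 * (lam * B) ^+ 2 - lam * eps)))%:E.
Proof.
move=> mZ mZ0 [indep law] mh hB h0 lam0 lamB.
have mhZ i : measurable_fun [set: Omega] (fun w => h (Z i w)).
  exact: measurableT_comp.
set S := fun w => (\sum_(i < n) h (Z i w))%R.
have mS : measurable_fun [set: Omega] S by apply: measurable_sum.
set A := [set w | _].
have mA : measurable A.
  exact: (measurable_set_ler (measurable_cst _) mS).
pose f := fun x : T => expR (lam * h x).
have mf : measurable_fun [set: T] f.
  by apply: measurableT_comp => //; exact: measurable_funM.
have fle x : (f x <= 1 + 2 * (lam * B) ^+ 2 + lam * h x)%R.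
  have /ler_normlP[h1 h2] := hB x.
  apply: le_trans (expR_le_quadratic _) _.
    by apply: le_trans lamB; rewrite ler_wpM2l.
  rewrite -[leRHS]addrA [in leRHS](addrC (2 * _)%R) addrA lerD2l ler_pM2l//
    !exprMn.
  by rewrite ler_wpM2l ?sqr_ge0// -ler_sqrt ?sqr_ge0//
    !sqrtr_sqr (le_trans (hB x))// ler_norm.
have intf i : \int[P]_w (f (Z i w))%:E <= (expR (2 * (lam * B) ^+ 2))%:E.
  rewrite (@integral_same_law (Z i) Z0 (EFin \o f))//=; last 2 first.
    exact/measurable_EFinP.
    by move=> x; rewrite lee_fin expR_ge0.
  have ih : P.-integrable setT (EFin \o (fun w => h (Z0 w))).
    apply: (@bounded_measurable_integrable _ B) => //; exact: measurableT_comp.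
  apply: (@le_trans _ _ (\int[P]_w ((1 + 2 * (lam * B) ^+ 2)%:E + (lam%:E * (h
    (Z0 w))%:E)))).
    apply: ge0_le_integral => //.
    - by move=> w _; rewrite lee_fin expR_ge0.
    - apply/measurable_EFinP; exact: measurableT_comp.
    - apply: emeasurable_funD; first exact: measurable_cst.
      by apply: measurable_funeM; apply/measurable_EFinP; exact:
        measurableT_comp.
    - by move=> w _; rewrite -EFinM -EFinD lee_fin.
  rewrite integralD//=; last 2 first.
    exact: finite_measure_integrable_cst.
    exact: integrableZl.
  rewrite integralZl// h0 mule0 adde0 integral_probability_cst lee_fin.
  exact: expR_ge1Dx.
(* Markov's inequality: the indicator of [A] is at most exp(lam (S - n eps)), which factors over the
   sample. *)
apply: (@le_trans _ _ (\int[P]_w ((expR (- (lam * (n%:R * eps))))%:E * (\prod_(i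
  < n) f (Z i w))%:E))).
  rewrite -[A in leLHS]setIT -integral_indic//.
  apply: ge0_le_integral => //.
  - apply/measurable_EFinP; exact: measurable_indic.
  - apply: measurable_funeM; apply/measurable_EFinP.
    by apply: measurable_prod => i _; exact: measurableT_comp.
  - move=> w _; rewrite -EFinM lee_fin -expR_sum -expRD -mulr_sumr indicE.
    case: (boolP (w \in A)) => [/set_mem Aw|_]; last by rewrite expR_ge0.
    rewrite -[leLHS]expR0 ler_expR addrC -mulrBr mulr_ge0// subr_ge0.
    exact: Aw.
have mprod : measurable_fun [set: Omega] (fun w =>
  (\prod_(i < n) f (Z i w))%:E).
  apply/measurable_EFinP.
  by apply: measurable_prod => i _; exact: measurableT_comp.
have prod0 w : 0 <= (\prod_(i < n) f (Z i w))%:E.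
  by rewrite lee_fin prodr_ge0// => i _; rewrite expR_ge0.
rewrite (ge0_integralZl _ measurableT mprod (fun w _ => prod0 w))//.
rewrite (@expectation_prod_independent Z n (fun=> f))//; last 2 first.
- by move=> i x; rewrite expR_ge0.
- by move=> i; rewrite (le_lt_trans (intf i))// ltry.
rewrite mulrBr expRD EFinM [X in _ <= X]muleC.
rewrite (mulrCA n%:R%R) lee_wpmul2l ?lee_fin ?expR_ge0//.
apply: (@le_trans _ _ (\prod_(i < n) (expR (2 * (lam * B) ^+ 2))%:E)).
  suff: 0 <= \prod_(i < n) \int[P]_w (f (Z i w))%:E /\
      \prod_(i < n) \int[P]_w (f (Z i w))%:E <=
      \prod_(i < n) (expR (2 * (lam * B) ^+ 2))%:E by case.
  apply: (big_ind2 (fun x y : \bar R => 0 <= x /\ x <= y)) => //.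
    by move=> x1 x2 y1 y2 [? ?] [? ?]; rewrite mule_ge0// lee_pmul.
  by move=> i _; rewrite intf integral_ge0// => w _; rewrite lee_fin expR_ge0.
by rewrite prodEFin prodr_const card_ord lee_fin (expRM_natl n).
Qed.

(** The Chernoff bound is applied to both signs of the centred [g]. The rate [K] is fixed before
    [Z], [g] and [n], because the union bound needs one rate for all predictors and for all values
    of the prototypes. *)
Lemma hoeffding_iid (L eps : R) : (0 < eps)%R -> exists2 K : R, (0 < K)%R &
  forall (Z : nat -> Omega -> T) (Z0 : Omega -> T) (g : T -> R) (n : nat),
  (forall i, measurable_fun [set: Omega] (Z i)) ->
  measurable_fun [set: Omega] Z0 ->
  iid_copies P Z Z0 -> measurable_fun [set: T] g ->
  (forall x, 0 <= g x <= L)%R ->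
  P [set w | n%:R * eps <=
      `|\sum_(i < n) g (Z i w) - n%:R * fine (\int[P]_w (g (Z0 w))%:E)|]%R <=
    (2 * expR (- (K * n%:R)))%:E.
Proof.
move=> eps0.
pose B := (`|L| + 1)%R; have B1 : (1 <= B)%R by rewrite lerDr.
have B0 : (0 < B)%R by exact: lt_le_trans B1.
pose e := Num.min 1%R eps; have e0 : (0 < e)%R by rewrite lt_min ltr01.
have e1 : (e <= 1)%R by rewrite ge_min lexx.
have ee : (e <= eps)%R by rewrite ge_min lexx orbT.
(* This [lam] gives 2(lam B)^2 = lam e / 2 <= lam eps / 2, so half of the linear term survives in
   the exponent. Truncating [eps] at 1 and taking B >= 1 ensure lam B <= 1/4. *)
pose lam := (e / (4 * B ^+ 2))%R.
have B20 : (0 < 4 * B ^+ 2)%R by rewrite mulr_gt0// exprn_gt0.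
have lam0 : (0 < lam)%R by rewrite divr_gt0.
have lamE : (4 * (lam * B ^+ 2) = e)%R.
  by rewrite /lam; field; rewrite lt0r_neq0.
exists (lam * eps / 2)%R; first by rewrite divr_gt0// mulr_gt0.
move=> Z Z0 g n mZ mZ0 iid mg gL.
have lamB : (lam * B <= 2^-1)%R.
  have : (lam * B <= lam * B ^+ 2)%R.
    by rewrite ler_wpM2l ?(ltW lam0)// expr2 ler_peMl// ltW.
  lra.
have expo : (2 * (lam * B) ^+ 2 - lam * eps <= - (lam * eps / 2))%R.
  have -> : (2 * (lam * B) ^+ 2 = lam * (4 * (lam * B ^+ 2)) / 2)%R by field.
  rewrite lamE; have : (lam * e <= lam * eps)%R by rewrite ler_wpM2l// ltW.
  lra.
have bnd : (expR (n%:R * (2 * (lam * B) ^+ 2 - lam * eps)) <=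
   expR (- (lam * eps / 2 * n%:R)))%R.
  by rewrite ler_expR [leLHS]mulrC -[leRHS]mulNr ler_wpM2r.
set mu := fine _.
have mgZ (W : Omega -> T) : measurable_fun [set: Omega] W ->
    measurable_fun [set: Omega] (fun w => g (W w)).
  by move=> mW; exact: measurableT_comp.
have ig : P.-integrable setT (EFin \o (fun w => g (Z0 w))).
  apply: (@bounded_measurable_integrable _ L); first exact: mgZ.
  by move=> w; have /andP[a b] := gL (Z0 w); rewrite ger0_norm.
have fing : \int[P]_w (g (Z0 w))%:E \is a fin_num.
  exact: (integrable_fin_num measurableT ig).
have mu0 : (0 <= mu)%R.
  by rewrite fine_ge0// integral_ge0// => w _; rewrite lee_fin; have /andP[] :=
    gL (Z0 w).
have muL (x : T) : (mu <= L)%R.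
  rewrite -lee_fin fineK//.
  apply: (@le_trans _ _ (\int[P]_w (cst L%:E w))).
    apply: ge0_le_integral => //.
    - by move=> w _; rewrite lee_fin; have /andP[] := gL (Z0 w).
    - by apply/measurable_EFinP; exact: mgZ.
    - by move=> w _; rewrite lee_fin; have /andP[] := gL (Z0 w).
  by rewrite integral_probability_cst.
have mean0 (s : R) : \int[P]_w (s * (g (Z0 w) - mu))%R%:E = 0.
  under eq_integral do rewrite EFinM EFinB.
  rewrite integralZl//; last first.
    by apply: integrableB => //; exact: finite_measure_integrable_cst.
  rewrite integralB//; last exact: finite_measure_integrable_cst.
  by rewrite integral_probability_cst fineK// subee// mule0.
have one (s : R) : (`|s| = 1)%R ->
    P [set w | n%:R * eps <= \sum_(i < n) (s * (g (Z i w) - mu))]%R <=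
    (expR (- (lam * eps / 2 * n%:R)))%:E.
  move=> s1; apply: (@le_trans _ _ (expR (n%:R * (2 * (lam * B) ^+ 2 - lam *
    eps)))%:E);
    last by rewrite lee_fin; exact: bnd.
  apply: (@chernoff_iid Z Z0 (fun x => s * (g x - mu))%R B lam eps n) => //.
  - by apply: measurable_funM => //; apply: measurable_funB.
  - move=> x; rewrite normrM s1 mul1r; have /andP[a b] := gL x; have c := muL x.
    by apply: normr_sub_le_bound; apply/andP; split.
  - exact: ltW.
have mE (s : R) : measurable [set w | n%:R * eps <=
  \sum_(i < n) (s * (g (Z i w) - mu))]%R.
  apply: measurable_set_ler; first exact: measurable_cst.
  apply: measurable_sum => i; apply: measurable_funM => //.
  by apply: measurable_funB => //; exact: mgZ.
apply: (@le_trans _ _ (P ([set w | n%:R * eps <=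
  \sum_(i < n) (1 * (g (Z i w) - mu))]%R `|`
   [set w | n%:R * eps <= \sum_(i < n) (-1 * (g (Z i w) - mu))]%R))).
  apply: le_measure; rewrite ?inE//.
  - apply: measurable_set_ler; first exact: measurable_cst.
    apply: measurableT_comp => //; apply: measurable_funB => //.
    by apply: measurable_sum => i; exact: mgZ.
  - exact: measurableU.
  - move=> w /=; rewrite -!mulr_sumr sumrB sumr_const card_ord -(mulr_natl mu n)
    mul1r mulN1r.
    by rewrite ler_normr => /orP[]; [left|right].
apply: le_trans (measureU2 _ _ _) _ => //.
by rewrite mulr2n mulrDl !mul1r EFinD leeD// one// ?normrN normr1.
Qed.

End independence.

(** * Finite approximation of countable unions, and dense sequences *)

Section small_tail.
Context d (T : measurableType d) (R : realType) (mu : probability T R).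

(** The remainders decrease to the empty set, so continuity from above applies. This is how
    countable covers become finite ones up to small probability. *)
Lemma probability_bigcup_tail (A : (set T)^nat) (e : R) :
  (forall i, measurable (A i)) -> 0 < e ->
  exists N, (mu (\bigcup_i A i `\` \big[setU/set0]_(i < N) A i) <= e%:E)%E.
Proof.
move=> mA e0; pose F n := \bigcup_i A i `\` \big[setU/set0]_(i < n) A i.
have mF n : measurable (F n).
  by apply: measurableD; [exact: bigcup_measurable|exact: bigsetU_measurable].
have F0 : \bigcap_n F n = set0.
  rewrite -subset0 => x Fx; have [[i _ Aix] _] := Fx 0%N I.
  have [_] := Fx i.+1 I; apply.
  by rewrite -bigcup_mkord; exists i => /=.
have : mu \o F @ \oo --> mu (\bigcap_n F n).
  apply: nonincreasing_cvg_mu => //.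
  - by rewrite (le_lt_trans (probability_le1 _ _))// ltry.
  - by rewrite F0.
  - move=> n m nm; apply/subsetPset => x [Ax Fx]; split => //.
    by apply: contra_not Fx; apply: subset_bigsetU.
rewrite F0 measure0 => /fine_cvgP[_ /cvgrPdist_le/(_ e e0)][N _ NF].
exists N; have := NF N (leqnn N); rewrite sub0r normrN.
rewrite -lee_fin => H; apply: le_trans H.
by rewrite -(fineK (fin_num_measure mu _ (mF N))) lee_fin ler_norm.
Qed.

End small_tail.

Lemma separable_dense_seq (R : realType) (T : pseudoMetricType R) (x0 : T) :
  separable T ->
  exists e : nat -> T, forall x (r : R), 0 < r -> exists n, ball x r (e n).
Proof.
move=> [D /countable_injP[f finj] Dd].
(* A left inverse of the injection [f] of the dense set into the integers; indices outside its image
   get the default [x0]. *)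
exists (fun n => xget x0 [set x | D x /\ f x = n]) => x r r0.
have [|y [/= xy Dy]] := Dd (ball x r)° _ (@open_interior _ _).
  by exists x; exact: nbhsx_ballx.
exists (f y); case: xgetP => [z _ [Dz fz]|/(_ y)]; last by case.
by rewrite (finj z y) ?inE//; exact: interior_subset.
Qed.

(** * Borel sets of a metric space *)

Section metric.
Context (R : realType) (T : pmetricType R).

Lemma open_mdist_lt (x : T) (r : R) : open [set y | mdist x y < r].
Proof.
rewrite openE => y /= xy; apply/nbhs_ballP; exists (r - mdist x y) => /=.
  by rewrite subr_gt0.
move=> z; rewrite ballEmdist /= => yz.
by rewrite (le_lt_trans (metric_triangle x y z))// addrC -ltrBrDr.
Qed.

Lemma open_mdist_gt (x : T) (r : R) : open [set y | r < mdist x y].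
Proof.
rewrite openE => y /= xy; apply/nbhs_ballP; exists (mdist x y - r) => /=.
  by rewrite subr_gt0.
move=> z; rewrite ballEmdist /= => yz.
by have := metric_triangle x z y; rewrite (metric_sym z y); lra.
Qed.

Lemma separable_mdist : separable T ->
  exists e : nat -> T, forall x (r : R), 0 < r -> exists n, mdist x (e n) < r.
Proof.
move=> /(separable_dense_seq point)[e ed]; exists e => x r /(ed x)[n].
by rewrite ballEmdist; exists n.
Qed.

Lemma exists_inv_lt (r : R) : 0 < r -> exists q : nat, q.+1%:R^-1 < r.
Proof.
move=> r0; exists (Num.bound r^-1).
rewrite invf_plt ?posrE// (lt_le_trans (archi_boundP _)) ?invr_ge0 ?ltW//.
by rewrite ltr_nat.
Qed.

(** Continuity alone gives measurability for the Borel sets of the product, whereas the product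
    sigma-algebra is meant here. Separability writes {mdist > r} as a countable union of rectangles:
    x is within 1/(q+1) of some [e n] whose distance to y exceeds r + 1/(q+1). *)
Lemma measurable_mdist : separable T ->
  measurable_fun [set: borel T * borel T]
    (fun p : borel T * borel T => mdist (p.1 : T) (p.2 : T) : R).
Proof.
move=> /separable_mdist[e ed] mD.
apply: (measurability _ (RGenOInfty.measurableE R)) => //.
move=> /= _ [_ [r ->] <-]; rewrite setTI preimage_itvoy.
rewrite [X in measurable X](_ : _ = \bigcup_n \bigcup_q
  ([set x : T | mdist (e n) x < q.+1%:R^-1] `*`
   [set x : T | r + q.+1%:R^-1 < mdist (e n) x])).
  apply: bigcup_measurable => n _; apply: bigcup_measurable => q _.
  by apply: measurableX; apply: sub_sigma_algebra;
    [exact: open_mdist_lt|exact: open_mdist_gt].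
apply/seteqP; split=> [[x y] /= rxy|[x y] [n _ [q _ [/= nx ny]]]].
  have [q qr] : exists q : nat, q.+1%:R^-1 < (mdist x y - r) / 2.
    by apply: exists_inv_lt; rewrite divr_gt0// subr_gt0.
  have [n xn] := ed x (q.+1%:R^-1) ltac:(by rewrite invr_gt0).
  exists n => //; exists q => //; split => /=; first by rewrite metric_sym.
  move: (metric_triangle x (e n) y) xn qr.
  by move: (q.+1%:R^-1 : R) => t ? ? ?; lra.
move: (metric_triangle (e n) x y) nx ny.
by move: (q.+1%:R^-1 : R) => t ? ? ?; lra.
Qed.

(** * Sets at positive distance from their complement, up to small measure *)

Section uniform_separation.
Variable mu : probability (borel T) R.

(** On [E] the traces of [A] and of its complement are at distance at least [r]; equivalently,
    membership in [A] is constant at scale [r] within [E]. *)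
Definition uniformly_separated (A : set T) := forall e : R, 0 < e ->
  exists r : R, exists E : set (borel T), [/\ 0 < r, measurable E,
    (mu (~` E) <= e%:E)%E &
    forall x x', E x -> E x' -> mdist x x' < r -> A x -> A x'].

Lemma uniformly_separatedC A :
  uniformly_separated A -> uniformly_separated (~` A).
Proof.
move=> sA e e0; have [r [E [r0 mE muE AE]]] := sA e e0.
exists r, E; split => // x x' Ex Ex' xx' Ax Ax'; apply: Ax.
by apply: (AE x') => //; rewrite metric_sym.
Qed.

Lemma uniformly_separatedU A B : uniformly_separated A ->
  uniformly_separated B -> uniformly_separated (A `|` B).
Proof.
move=> sA sB e e0; have e20 : 0 < e / 2 by rewrite divr_gt0.
have [r [E [r0 mE muE AE]]] := sA _ e20.
have [s [F [s0 mF muF BF]]] := sB _ e20.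
exists (Num.min r s), (E `&` F); split.
- by rewrite lt_min r0.
- exact: measurableI.
- rewrite setCI (le_trans (measureU2 _ _ _))//; try exact: measurableC.
  by rewrite [in leRHS](splitr e) EFinD leeD.
- move=> x x' [Ex Fx] [Ex' Fx']; rewrite lt_min => /andP[xr xs] [Ax|Bx].
    by left; exact: (AE x).
  by right; exact: (BF x).
Qed.

Lemma uniformly_separated_bigcup (A : (set T)^nat) :
  (forall i, measurable (A i : set (borel T))) ->
  (forall i, uniformly_separated (A i)) ->
  uniformly_separated (\bigcup_i A i).
Proof.
move=> mA sA e e0; have e20 : 0 < e / 2 by rewrite divr_gt0.
have [N muN] := probability_bigcup_tail mu mA e20.
set B := \big[setU/set0]_(i < N) A i in muN.
have sB : uniformly_separated B.
  rewrite /B; elim/big_ind : _ => //; last exact: uniformly_separatedU.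
  move=> e' e'0; exists 1, setT; split => //.
  by rewrite setCT measure0 lee_fin ltW.
have mB : measurable (B : set (borel T)) by exact: bigsetU_measurable.
have mbA : measurable (\bigcup_i A i : set (borel T)).
  exact: bigcup_measurable.
have [r [E [r0 mE muE BE]]] := sB _ e20.
(* Once the tail of the union is discarded, lying in the infinite union and lying in the finite
   union [B] are the same. *)
exists r, (E `&` ~` (\bigcup_i A i `\` B)); split => //.
- by apply: measurableI => //; apply: measurableC; exact: measurableD.
- rewrite setCI setCK (le_trans (measureU2 _ _ _))//.
  + exact: measurableC.
  + exact: measurableD.
  + by rewrite [in leRHS](splitr e) EFinD leeD.
- move=> x x' [Ex Bx] [Ex' _] xx' Ax.
  have [i /= iN Aix] : (\bigcup_(i < N) A i) x'.
    rewrite bigcup_mkord; apply: (BE x) => //.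
    by apply: contrapT => nB; apply: Bx; split.
  by exists i.
Qed.

(** The points whose 1/(n+1)-ball lies in [U] form closed sets that exhaust [U]. Together with the
    complement of [U] they exhaust the space, so finitely many of them cover it up to measure [e],
    which provides the scale. *)
Lemma uniformly_separated_open (U : set T) : open U -> uniformly_separated U.
Proof.
move=> oU e e0.
pose V n := [set x : T | forall y, mdist x y < n.+1%:R^-1 -> U y].
have mV n : measurable (V n : set (borel T)).
  rewrite -[V n]setCK; apply: measurableC; apply: sub_sigma_algebra.
  rewrite /= [X in open X](_ : _ =
      \bigcup_(y in ~` U) [set x | mdist y x < n.+1%:R^-1]).
    by apply: bigcup_open => y _; exact: open_mdist_lt.
  apply/seteqP; split=> x.
    move=> /existsNP[y /not_implyP[xy Uy]].
    by exists y => //=; rewrite metric_sym.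
  by move=> [y Uy /= yx] /(_ y); rewrite metric_sym => /(_ yx).
have mU : measurable (U : set (borel T)) by exact: sub_sigma_algebra.
pose A n : set (borel T) := V n `|` ~` U.
have mA n : measurable (A n) by apply: measurableU => //; exact: measurableC.
have AT : \bigcup_n A n = setT.
  rewrite -subTset => x _; have [Ux|Ux] := pselect (U x); last by exists 0%N =>
    //; right.
  have : nbhs x U by move: oU; rewrite openE; exact.
  move=> /nbhs_ballP[r /= r0 rU]; have [q qr] := exists_inv_lt r0.
  exists q => //; left => y xy; apply: rU; rewrite ballEmdist/=.
  exact: lt_trans xy qr.
have [N muN] := probability_bigcup_tail mu mA e0.
exists N.+1%:R^-1, (\big[setU/set0]_(i < N) A i); split.
- by rewrite invr_gt0.
- exact: bigsetU_measurable.
- by rewrite -setTD -AT.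
- move=> x x' + _ xx' Ux; rewrite -bigcup_mkord => -[i /= iN [Vx|//]].
  apply: Vx; apply: lt_le_trans xx' _.
  by rewrite lef_pV2 ?posrE// ler_nat ltnS ltnW.
Qed.

(* An approximation of sets by uniformly separated ones: a substitute, valid
   in every metric space, for Lusin's theorem. *)
Lemma measurable_uniformly_separated (A : set (borel T)) :
  measurable A -> uniformly_separated A.
Proof.
(* It suffices that [G] is a sigma-algebra containing the open sets. *)
move=> mA; pose G := [set A : set (borel T) | measurable A /\
  uniformly_separated A].
suff : G A by case.
move: A mA; apply: smallest_sub; last first.
  move=> U oU; split; first exact: sub_sigma_algebra.
  exact: uniformly_separated_open.
split.
- split; first exact: measurable0.
  move=> e e0; exists 1, setT; split => //.
  by rewrite setCT measure0 lee_fin ltW.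
- move=> A [mA sA]; rewrite setTD; split; first exact: measurableC.
  exact: uniformly_separatedC.
- move=> A GA; split; first by apply: bigcup_measurable => i _; case: (GA i).
  by apply: uniformly_separated_bigcup => i; case: (GA i).
Qed.

(** Finitely many of the [B i] cover up to e/2, and finitely many sets have a common scale, the
    minimum of theirs. With [B i] the preimages of small balls under a measurable map, nearby points
    of [E] have images in a common small ball. *)
Lemma uniformly_separated_cover (B : (set (borel T))^nat) (e : R) :
  (forall i, measurable (B i)) -> \bigcup_i B i = setT -> 0 < e ->
  exists N : nat, exists r : R, exists E : set (borel T),
    [/\ 0 < r, measurable E, (mu (~` E) <= e%:E)%E,
      forall x, E x -> exists2 i, (i < N)%N & B i x &
      forall x x' i, E x -> E x' -> mdist (x : T) x' < r -> (i < N)%N ->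
        B i x -> B i x'].
Proof.
move=> mB BT e0; have e20 : 0 < e / 2 by rewrite divr_gt0.
have [N muN] := probability_bigcup_tail mu mB e20.
suff: forall M (e : R), 0 < e -> exists r : R, exists E : set (borel T),
    [/\ 0 < r, measurable E, (mu (~` E) <= e%:E)%E &
      forall x x' i, E x -> E x' -> mdist (x : T) x' < r -> (i < M)%N ->
        B i x -> B i x'].
  move=> /(_ N _ e20)[r [E [r0 mE muE BE]]].
  have mBN : measurable (\big[setU/set0]_(i < N) B i) by exact:
    bigsetU_measurable.
  exists N, r, (E `&` \big[setU/set0]_(i < N) B i); split => //.
  - exact: measurableI.
  - rewrite setCI (le_trans (measureU2 _ _ _))//; try exact: measurableC.
    by rewrite [in leRHS](splitr e) EFinD leeD// -setTD -BT.
  - by move=> x [_]; rewrite -bigcup_mkord => -[i /= iN Bi]; exists i.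
  - by move=> x x' i [Ex _] [Ex' _]; exact: BE.
elim=> [|M IHM] {e0 e20 muN}e e0.
  exists 1, setT; split => //.
  by rewrite setCT measure0 lee_fin ltW.
have e20 : 0 < e / 2 by rewrite divr_gt0.
have [r [E [r0 mE muE BE]]] := IHM _ e20.
have [s [F [s0 mF muF BF]]] := measurable_uniformly_separated (mB M) e20.
exists (Num.min r s), (E `&` F); split.
- by rewrite lt_min r0.
- exact: measurableI.
- rewrite setCI (le_trans (measureU2 _ _ _))//; try exact: measurableC.
  by rewrite [in leRHS](splitr e) EFinD leeD.
- move=> x x' i [Ex Fx] [Ex' Fx']; rewrite lt_min => /andP[xr xs].
  rewrite ltnS leq_eqVlt => /orP[/eqP ->|iM]; first exact: BF.
  exact: BE.
Qed.

(** Balls of radius [r] around the dense points cover the space, and those of measure zero have a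
    null union. Finitely many of the others suffice up to [eps]; each has a nucleus within [r] of
    its centre, hence within 2r of all its points. *)
Lemma near_nuclei (c e : nat -> T) (r eps : R) :
  (forall x (s : R), 0 < s -> exists n, mdist x (e n) < s) ->
  0 < r -> 0 < eps ->
  (forall i, (0 < mu [set x : T | (mdist (e i) x < r)%R])%E ->
    exists j, mdist (e i) (c j) < r) ->
  exists K : nat, exists E : set (borel T),
    [/\ measurable E, (mu (~` E) <= eps%:E)%E &
      forall x, E x -> exists2 j, (j < K)%N & mdist (x : T) (c j) < r + r].
Proof.
move=> ed r0 eps0 hit; pose b i : set (borel T) := [set x :
  T | mdist (e i) x < r].
have mb i : measurable (b i) by apply: sub_sigma_algebra; exact: open_mdist_lt.
(* Null balls are emptied, since no nucleus is guaranteed near their centres. *)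
pose A i := if mu (b i) == 0%E then set0 else b i.
have mA i : measurable (A i) by rewrite /A; case: ifP.
have [N muN] := probability_bigcup_tail mu mA eps0.
have /choice[J HJ] : forall i, exists j, forall x, A i x ->
  mdist (e i) (c j) < r.
  move=> i; rewrite /A; case: ifPn => [_|b0]; first by exists 0%N.
  have [|j ij] := hit i; first by rewrite lt0e b0/=.
  by exists j.
exists (\max_(i < N) J i).+1, (\big[setU/set0]_(i < N) A i); split.
- exact: bigsetU_measurable.
- have mUA : measurable (\bigcup_i A i) by exact: bigcup_measurable.
  have mUN : measurable (\big[setU/set0]_(i < N) A i) by exact:
    bigsetU_measurable.
  have null : mu (~` \bigcup_i A i) = 0%E.
    apply/eqP; rewrite eq_le measure_ge0 andbT.
    apply: (@le_trans _ _ (mu (\bigcup_i (b i `\` A i)))).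
      apply: le_measure; rewrite ?inE//; first exact: measurableC.
        by apply: bigcup_measurable => i _; exact: measurableD.
      move=> x Ax; have [i xi] := ed x r r0; exists i => //; split.
        by rewrite /b/= metric_sym.
      by move=> Aix; apply: Ax; exists i.
    have : mu.-negligible (\bigcup_i (b i `\` A i)).
      apply: negligible_bigcup => i.
      apply/negligibleP; first exact: measurableD.
      rewrite /A; case: ifPn => [/eqP b0|_]; first by rewrite setD0.
      by rewrite setDv measure0.
    move/negligibleP => -> //.
    by apply: bigcup_measurable => i _; exact: measurableD.
  apply: (@le_trans _ _ (mu (~` (\bigcup_i A i) `|`
      (\bigcup_i A i `\` \big[setU/set0]_(i < N) A i)))).
    apply: le_measure; rewrite ?inE//; first exact: measurableC.
      by apply: measurableU; [exact: measurableC|exact: measurableD].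
    move=> x Nx; have [Ax|Ax] := pselect ((\bigcup_i A i) x); last by left.
    by right.
  rewrite (le_trans (measureU2 _ _ _))//; [exact: measurableC|exact:
    measurableD|].
  have null0 : (mu (~` \bigcup_i A i) <= 0)%E by rewrite null.
  by apply: le_trans (leeD null0 muN) _; rewrite add0e.
- move=> x; rewrite -bigcup_mkord => -[i /= iN Aix].
  exists (J i); first by rewrite ltnS (leq_bigmax (Ordinal iN)).
  have ij := HJ i x Aix; move: Aix; rewrite /A; case: ifP => // _ xi.
  by rewrite (le_lt_trans (metric_triangle x (e i) (c (J i))))// ltrD//
    metric_sym.
Qed.

End uniform_separation.

(** * Voronoi cells *)

Section voronoi_partition.
Implicit Types (c : nat -> T) (x : T).

(** [closer c x] is the lexicographic order of the pairs (distance to x, index). Transitivity,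
    totality and irreflexivity make it a strict total order, so each point has exactly one winner:
    the cells form a partition. *)
Lemma closer_trans c x i j l : closer c x i j -> closer c x j l ->
  closer c x i l.
Proof.
rewrite /closer => /orP[ij|/andP[/eqP ij lij]] /orP[jl|/andP[/eqP jl ljl]].
- by rewrite (lt_trans ij jl).
- by rewrite -jl ij.
- by rewrite ij jl.
- by rewrite ij jl eqxx (ltn_trans lij ljl) orbT.
Qed.

Lemma closer_total c x i j : i != j -> closer c x i j || closer c x j i.
Proof.
rewrite /closer neq_ltn; case: ltgtP => //= ij /orP[->|->] //; by rewrite ?orbT.
Qed.

Lemma closer_irr c x i : ~~ closer c x i i.
Proof. by rewrite /closer ltxx ltnn andbF. Qed.

Lemma voronoi_cover c k x : (0 < k)%N -> exists2 j, (j < k)%N & voronoi c k j x.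
Proof.
case: k => // k _; elim: k => [|k [j jk cj]].
  by exists 0%N => // i; rewrite ltnS leqn0 => /eqP ->.
have : j != k.+1 by rewrite neq_ltn jk.
move=> /(closer_total c x)/orP[jk1|k1j].
  exists j; first exact: ltnW.
  move=> i; rewrite ltnS leq_eqVlt => /orP[/eqP -> //|ik]; exact: cj.
exists k.+1 => // i; rewrite ltnS leq_eqVlt => /orP[/eqP ->|ik _].
  by rewrite eqxx.
have [->//|ij] := eqVneq i j; apply: closer_trans k1j _.
exact: cj.
Qed.

Lemma voronoi_inj c k i j x : (i < k)%N -> (j < k)%N ->
  voronoi c k i x -> voronoi c k j x -> i = j.
Proof.
move=> ik jk ci cj; apply: contrapT => /eqP ij.
have /negP := closer_irr c x i; apply.
by apply: (closer_trans (ci _ jk _) (cj _ ik _)); rewrite // eq_sym.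
Qed.

Lemma voronoi_nearest c k i j x : (i < k)%N -> voronoi c k j x ->
  mdist x (c j) <= mdist x (c i).
Proof.
move=> ik cj; have [->//|ij] := eqVneq i j.
by have /orP[/ltW//|/andP[/eqP ->]] := cj _ ik ij.
Qed.

(** Joint measurability in the parameter and the point is required because the nuclei are random. *)
Lemma measurable_voronoi d (S : measurableType d) (c : nat -> S ->
  borel T) k j :
  separable T -> (forall i, measurable_fun [set: S] (c i)) ->
  measurable [set p : S * borel T | voronoi (fun i => c i p.1) k j p.2].
Proof.
move=> sT mc.
have md i : measurable_fun [set: S * borel T]
    (fun p : S * borel T => mdist (p.2 : T) (c i p.1 : T)).
  apply: (measurableT_comp (measurable_mdist sT)
    (g := fun p : S * borel T => (p.2, c i p.1))) => //.
  apply: measurable_fun_pair => //.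
  exact: measurableT_comp (mc i) measurable_fst.
rewrite [X in measurable X](_ : _ = \bigcap_(i in [set i | (i < k)%N && (i !=
  j)])
  [set p : S * borel T | closer (fun i => c i p.1 : T) p.2 j i]); last first.
  apply/seteqP; split=> p H i; first by move=> /andP[]; exact: H.
  by move=> ik ij; apply: H; rewrite /= ik.
apply: bigcap_measurableType => i _.
have mb : measurable_fun [set: S * borel T]
    (fun p : S * borel T => closer (fun i => c i p.1 : T) p.2 j i).
  rewrite /closer; apply: measurable_or; first exact: measurable_fun_ltr.
  by apply: measurable_and; [exact: measurable_fun_eqr|exact: measurable_cst].
rewrite [X in measurable X](_ : _ = setT `&`
  (fun p : S * borel T => closer (fun i => c i p.1 :
    T) p.2 j i) @^-1` [set true]).
  exact: mb.
by rewrite setTI; apply/seteqP; split.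
Qed.

End voronoi_partition.

End metric.

(** * Disintegration and conditioning on the prototypes *)

Section disintegration.
Local Open Scope ereal_scope.
Context d dT dU (Omega : measurableType d) (T : measurableType dT)
  (U : measurableType dU) (R : realType) (P : probability Omega R)
  (X : {RV P >-> T}) (Y : {RV P >-> U}) (kappa : R.-pker T ~> U).
Hypothesis kappaP : regular_conditional_distribution P X Y kappa.

Let XY : Omega -> T * U := fun w => (X w, Y w).

Let mXY : measurable_fun [set: Omega] XY.
Proof. exact: measurable_fun_pair. Qed.

(** The law of [X] as a constant kernel on the one-point space, so that the product of kernels can
    be formed with it. *)
Let law_X : unit -> pprobability T R := cst (distribution P X :
  pprobability T R).

Let mlaw_X : measurable_fun [set: unit] law_X.
Proof. exact: measurable_cst. Qed.

(** The law of (X, Y) and the product of the law of [X] with [kappa] agree on rectangles by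
    [kappaP]; rectangles are stable under intersection and generate the product sigma-algebra. *)
Let joint (A : set (T * U)) : measurable A ->
  P (XY @^-1` A) = \int[P]_w kappa (X w) (xsection A (X w)).
Proof.
move=> mA.
pose nu : {measure set (T * U) -> \bar R} :=
  mkproduct (kprobability mlaw_X) (kernel.kernel_snd kappa) tt.
have nuE B : measurable B -> nu B = \int[P]_w kappa (X w) (xsection B (X w)).
  move=> mB; rewrite /nu /mkproduct/= /kproduct.
  under eq_integral do rewrite kernel.intker_indicE//.
  rewrite -(@ge0_integral_distribution _ _ _ _ _ P X
    (fun x => kappa x (xsection B x)))//.
  by apply: measurable_fun_xsection_finite_kernel; rewrite inE.
rewrite -nuE//.
pose XYm : {mfun Omega >-> (T * U)%type} :=
  HB.pack XY (isMeasurableFun.Build _ _ _ _ _ mXY).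
pose C : set (set (T * U)) := [set A `*` B | A in measurable & B in measurable].
apply: (measure_unique C (fun=> setT) _ _ _ _ (distribution P XYm) nu) => //.
- by rewrite measurable_prod_measurableType.
- move=> _ _ [A1 mA1 [A2 mA2 <-]] [B1 mB1 [B2 mB2 <-]].
  exists (A1 `&` B1); first exact: measurableI.
  by exists (A2 `&` B2); [exact: measurableI|rewrite setXI].
- by move=> _; exists setT => //; exists setT => //; rewrite setXTT.
- by rewrite bigcup_const//; exists 0%N.
- move=> _ [A1 mA1 [A2 mA2 <-]].
  rewrite nuE; last exact: measurableX.
  transitivity (P (X @^-1` A1 `&` Y @^-1` A2)); first by [].
  rewrite kappaP// [LHS]integral_mkcond; apply: eq_integral => w _.
  rewrite patchE; case: ifPn => [/set_mem XA|XA].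
    by rewrite in_xsectionX// inE.
  by rewrite notin_xsectionX ?measure0//; move: XA; rewrite !notin_setE.
- by move=> _; rewrite (le_lt_trans (probability_le1 _ _))// ltry.
Qed.

Lemma integral_disintegration (f : T * U -> \bar R) :
  measurable_fun [set: T * U] f -> (forall p, 0 <= f p) ->
  \int[P]_w f (X w, Y w) = \int[P]_w \int[kappa (X w)]_z f (X w, z).
Proof.
move: f.
have mfXY (f : T * U -> \bar R) : measurable_fun [set: T * U] f ->
  measurable_fun [set: Omega] (fun w => f (X w, Y w)).
  by move=> mf; exact: (measurableT_comp mf mXY).
have mfx (f : T * U -> \bar R) x : measurable_fun [set: T * U] f ->
    measurable_fun [set: U] (fun z => f (x, z)).
  by move=> mf; apply: measurableT_comp mf _; exact: measurable_pair1.
have mI (f : T * U -> \bar R) : measurable_fun [set: T * U] f ->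
    (forall p, 0 <= f p) ->
    measurable_fun [set: Omega] (fun w => \int[kappa (X w)]_z f (X w, z)).
  move=> mf f0; apply: (measurableT_comp (f := fun x => \int[kappa x]_z f (x,
    z))) => //.
  exact: measurable_fun_integral_finite_kernel.
have I0 (f : T * U -> \bar R) : (forall p, 0 <= f p) ->
  forall x, 0 <= \int[kappa x]_z f (x, z).
  by move=> f0 x; exact: integral_ge0.
apply: ge0_measurable_ind => [A mA|r f r0 mf f0 Qf|f g mf f0 mg g0 Qf Qg|].
- rewrite /=.
  transitivity (P (XY @^-1` A)).
    rewrite -[in RHS](setIT (XY @^-1` A)) -integral_indic//.
    by rewrite -[_ @^-1` _]setTI; exact: mXY.
  rewrite joint//; apply: eq_integral => w _.
  rewrite -[in LHS](setIT (xsection _ _)) -integral_indic//; last exact: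
    measurable_xsection.
  by apply: eq_integral => z _; rewrite !indicE mem_xsection.
- rewrite ge0_integralZl//; last exact: mfXY.
  rewrite Qf -ge0_integralZl//; [|exact: mI|by move=> w _; exact: I0].
  by apply: eq_integral => w _; rewrite ge0_integralZl//; exact: mfx.
- rewrite ge0_integralD//; [|exact: mfXY|exact: mfXY].
  rewrite Qf Qg -ge0_integralD//; [|by move=> w _; exact: I0|exact: mI|
    by move=> w _; exact: I0|exact: mI].
  by apply: eq_integral => w _; rewrite ge0_integralD//; exact: mfx.
move=> f_ mf_ f_0 ndf_ Qf_.
rewrite monotone_convergence//; last by move=> n; exact: mfXY.
under eq_fun do rewrite Qf_.
rewrite -monotone_convergence//; last 3 first.
- by move=> n; exact: mI.
- by move=> n w _; exact: I0.
- move=> w _ n m nm; apply: ge0_le_integral => //; [exact: mfx|exact: mfx|].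
  by move=> z _; exact: ndf_.
apply: eq_integral => w _; rewrite monotone_convergence//.
by move=> n; exact: mfx.
Qed.

End disintegration.

(** * Hitting sets of positive measure, and conditioning by independence *)

Section conditioning.
Local Open Scope ereal_scope.
Context d (Omega : measurableType d) (R : realType) (P : probability Omega R).

(** The first n points all miss [A] with probability q^n, where q < 1 is the probability of a single
    miss; letting n grow, missing forever is a null event. *)
Lemma independent_hit dT (T : measurableType dT) (Z : nat -> Omega -> T)
    (Z0 : Omega -> T) (A : set T) :
  (forall i, measurable_fun [set: Omega] (Z i)) ->
  measurable_fun [set: Omega] Z0 -> iid_copies P Z Z0 -> measurable A ->
  0 < P (Z0 @^-1` A) -> {ae P, forall w, exists j, A (Z j w)}.
Proof.
move=> mZ mZ0 [indep law] mA PA.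
have mpre (W : Omega -> T) B : measurable_fun [set: Omega] W -> measurable B ->
    measurable (W @^-1` B).
  by move=> mW mB; rewrite -[_ @^-1` _]setTI; exact: mW.
pose q := fine (P (Z0 @^-1` ~` A)).
have qE : P (Z0 @^-1` ~` A) = q%:E.
  by rewrite fineK// fin_num_measure//; apply: mpre => //; exact: measurableC.
have q1 : (`|q| < 1)%R.
  rewrite ger0_norm ?fine_ge0// -lte_fin -qE preimage_setC.
  rewrite probability_setC; last exact: mpre.
  by rewrite lteBlDr ?fin_num_measure//; [rewrite lteDl|exact: mpre].
pose N := \bigcap_j Z j @^-1` ~` A.
have mN : measurable N.
  by apply: bigcap_measurableType => j _; apply: mpre => //; exact: measurableC.
exists N; split => //; last first.
  by move=> w /= /forallNP H j _; exact: H.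
have Nq n : P N <= (q ^+ n)%:E.
  have := @independent_bigcap _ _ _ _ _ P Z (fun=> ~` A) n indep (fun=>
    measurableC mA).
  have qi i : P (Z i @^-1` ~` A) = q%:E by rewrite law//; exact: measurableC.
  under eq_bigr do rewrite qi.
  rewrite prodEFin prodr_const card_ord => <-.
  apply: le_measure; rewrite ?inE//.
  - by apply: bigcap_measurableType => j _; apply: mpre => //; exact:
    measurableC.
  - by move=> w Nw j _; exact: Nw.
apply/eqP; rewrite eq_le measure_ge0 andbT.
rewrite -(fineK (fin_num_measure P _ mN)) lee_fin leNgt; apply/negP => N0.
have /cvgrPdist_lt/(_ _ N0)[n _ /(_ n (leqnn n))] := cvg_expr q1.
rewrite sub0r normrN => qn; have := Nq n.
rewrite leNgt -(fineK (fin_num_measure P _ mN)) lte_fin => /negP; apply.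
by apply: le_lt_trans qn; exact: ler_norm.
Qed.

Lemma sub_sigma_id_measurable (G : set (set Omega)) : G `<=` measurable ->
  measurable_fun [set: Omega] (id : Omega -> g_sigma_algebraType G).
Proof.
move=> Gm _ A mA; rewrite setTI preimage_id.
exact: (smallest_sub (@sigma_algebra_measurable _ Omega) Gm).
Qed.

(* By independence the diagonal map sends [P] to a product measure. *)
Lemma independent_le (G1 G2 : set (set Omega)) (b : R)
    (E : set (g_sigma_algebraType G1 * g_sigma_algebraType G2)) :
  G1 `<=` measurable -> G2 `<=` measurable ->
  (forall A B, <<s G1 >> A -> <<s G2 >> B -> P (A `&` B) = P A * P B) ->
  measurable E ->
  (forall w1, P [set w2 : Omega | E (w1, w2)] <= b%:E) ->
  measurable [set w : Omega | E (w, w)] /\ P [set w : Omega | E (w, w)] <= b%:E.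
Proof.
move=> G1m G2m indep mE Eb.
pose i1 : {mfun Omega >-> g_sigma_algebraType G1} :=
  HB.pack (id : Omega -> g_sigma_algebraType G1)
    (isMeasurableFun.Build _ _ _ _ _ (sub_sigma_id_measurable G1m)).
pose i2 : {mfun Omega >-> g_sigma_algebraType G2} :=
  HB.pack (id : Omega -> g_sigma_algebraType G2)
    (isMeasurableFun.Build _ _ _ _ _ (sub_sigma_id_measurable G2m)).
pose diag : {mfun Omega >-> (g_sigma_algebraType G1 * g_sigma_algebraType
  G2)%type} :=
  HB.pack (fun w => (i1 w, i2 w)) (isMeasurableFun.Build _ _ _ _ _
    (measurable_fun_pair (measurable_funP i1) (measurable_funP i2))).
have mD : measurable [set w : Omega | E (w, w)].
  by rewrite -[X in measurable X]setTI; exact: (measurable_funP diag).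
split => //.
have -> : P [set w : Omega | E (w, w)] = (distribution P i1 \x distribution P
  i2) E.
  apply/esym; apply: (@product_measure_unique _ _ _ _ _
    (distribution P i1) (distribution P i2) (distribution P diag)) => //.
apply: (@le_trans _ _ (\int[distribution P i1]_w1 (cst b%:E w1))).
  apply: ge0_le_integral => //.
  - exact: measurable_fun_xsection.
  - by move=> w1 _ /=; rewrite xsectionE; exact: Eb.
by rewrite integral_probability_cst.
Qed.

(** The family generating [sigma_generated measurable Z], named so that Omega equipped with the
    generated sigma-algebra becomes a type. *)
Definition sigma_generators dT (T : measurableType dT) (Z : nat -> Omega ->
  T) :=
  [set B | exists i, exists2 A, measurable A & B = Z i @^-1` A].

Lemma sigma_generators_measurable dT (T : measurableType dT) (Z : nat ->
  Omega -> T) :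
  (forall i, measurable_fun [set: Omega] (Z i)) ->
  sigma_generators Z `<=` measurable.
Proof.
by move=> mZ _ [i [A mA ->]]; rewrite -[_ @^-1` _]setTI; exact: mZ.
Qed.

Lemma measurable_sigma_generators dT (T : measurableType dT)
    (Z : nat -> Omega -> T) i :
  measurable_fun [set: g_sigma_algebraType (sigma_generators Z)]
    (Z i : g_sigma_algebraType (sigma_generators Z) -> T).
Proof.
move=> _ A mA; rewrite setTI; apply: sub_sigma_algebra.
by exists i; exists A.
Qed.

(* The concentration inequality conditionally on the prototypes [W]: given
   those, the summands are i.i.d. *)
Lemma conditional_hoeffding dT dU (T : measurableType dT) (U :
  measurableType dU)
    (L eps : R) : (0 < eps)%R -> exists2 K : R, (0 < K)%R &
  forall
    (W : nat -> Omega -> U) (Z : nat -> Omega -> T) (Z0 : Omega -> T)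
    (h : Omega -> T -> R) (n : nat),
  (forall i, measurable_fun [set: Omega] (W i)) ->
  (forall i, measurable_fun [set: Omega] (Z i)) ->
  measurable_fun [set: Omega] Z0 ->
  independent_sequences P W Z ->
  iid_copies P Z Z0 ->
  measurable_fun [set: g_sigma_algebraType (sigma_generators W) * T]
    (fun p : g_sigma_algebraType (sigma_generators W) * T => h p.1 p.2) ->
  (forall w x, 0 <= h w x <= L)%R ->
  let D := [set w | n%:R * eps <=
      `|\sum_(i < n) h w (Z i w) - n%:R * fine (\int[P]_w' (h w (Z0 w'))%:E)|]%R
        in
  measurable D /\ P D <= (2 * expR (- (K * n%:R)))%:E.
Proof.
move=> eps0; have [K K0 HK] := @hoeffding_iid _ _ Omega T _ P L eps eps0.
exists K => // W Z Z0 h n mW mZ mZ0 indep iid mh hL D.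
pose GW := g_sigma_algebraType (sigma_generators W).
pose GZ := g_sigma_algebraType (sigma_generators Z).
(* The two roles of the sample point are decoupled: [p.1] drives the prototypes and [p.2] the data,
   and [D] is the diagonal trace of [E]. *)
pose E : set (GW * GZ) := [set p | n%:R * eps <=
  `|\sum_(i < n) h p.1 (Z i p.2) - n%:R * fine (\int[P]_w' (h p.1 (Z0
    w'))%:E)|]%R.
have mmean : measurable_fun [set: GW] (fun w1 =>
  fine (\int[P]_w' (h w1 (Z0 w'))%:E)).
  apply: measurableT_comp => //.
  apply: (@measurable_fun_fubini_tonelli_F _ _ GW Omega R P
    (fun p : GW * Omega => (h p.1 (Z0 p.2))%:E)).
    apply/measurable_EFinP.
    apply: (measurableT_comp mh (g := fun p : GW * Omega => (p.1, Z0 p.2))).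
    by apply: measurable_fun_pair => //; exact:
      measurableT_comp mZ0 measurable_snd.
  by move=> p; rewrite lee_fin; have /andP[] := hL p.1 (Z0 p.2).
have mE : measurable E.
  apply: measurable_set_ler; first exact: measurable_cst.
  apply: measurableT_comp => //; apply: measurable_funB.
    apply: measurable_sum => i.
    apply: (measurableT_comp mh (g := fun p : GW * GZ => (p.1, Z i p.2))).
    apply: measurable_fun_pair => //.
    exact: measurableT_comp (@measurable_sigma_generators _ _ Z i)
      measurable_snd.
  apply: measurable_funM => //; exact: measurableT_comp mmean measurable_fst.
apply: (independent_le (sigma_generators_measurable mW)
  (sigma_generators_measurable mZ) indep mE) => w1.
exact: (HK Z Z0 (h w1) n mZ mZ0 iid (measurableT_comp mh (measurable_pair1 w1))
  (hL w1)).
Qed.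

End conditioning.

(** * Approximation error *)

Section cell_loss.
Context (R : realType) (XX : pmetricType R) (YY : completeNormedModType R)
  (l : YY -> YY -> R) (L : R).
Hypothesis sepX : separable XX.
Hypothesis l_meas : measurable_fun [set: borel YY * borel YY]
  (fun p : borel YY * borel YY => l p.1 p.2).
Hypothesis l_ge0 : forall y y', 0 <= l y y'.
Hypothesis l_bounded : forall y y', l y y' <= L.

(* The loss of the predictor that is constant, equal to [y' (s j)], on the
   [j]-th Voronoi cell. *)
Definition cell_loss (c : nat -> XX) (y' : nat -> YY) (k : nat) (s : 'I_k ->
  nat)
    (p : borel XX * borel YY) : R :=
  \sum_(j < k) l p.2 (y' (s j)) * \1_(voronoi c k j) p.1.

Lemma cell_lossE c y' k (s : 'I_k -> nat) (j : 'I_k) x y :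
  voronoi c k j x -> cell_loss c y' s (x, y) = l y (y' (s j)).
Proof.
move=> cj; rewrite /cell_loss (bigD1 j)//= indicE mem_set// mulr1.
rewrite big1 ?addr0// => i ij; rewrite indicE memNset ?mulr0// => ci.
by move/eqP: ij; apply; apply: val_inj; exact: voronoi_inj ci cj.
Qed.

Lemma cell_loss_itv c y' k (s : 'I_k -> nat) p : (0 < k)%N ->
  0 <= cell_loss c y' s p <= L.
Proof.
case: p => x y k0; have [j jk cj] := voronoi_cover c x k0.
by rewrite (@cell_lossE c y' k s (Ordinal jk))// l_ge0 l_bounded.
Qed.

(** [S] is abstract so as to be instantiated both by Omega with the sigma-algebra generated by the
    prototypes and, for fixed prototypes, by [unit]. *)
Lemma measurable_cell_loss d (S : measurableType d) (c : nat -> S -> borel XX)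
    (y' : nat -> S -> borel YY) k (s : 'I_k -> nat) :
  (forall i, measurable_fun [set: S] (c i)) ->
  (forall i, measurable_fun [set: S] (y' i)) ->
  measurable_fun [set: S * (borel XX * borel YY)]
    (fun p : S * (borel XX * borel YY) =>
      cell_loss (fun i => c i p.1 : XX) (fun i => y' i p.1 : YY) s p.2).
Proof.
move=> mc my; apply: measurable_sum => j; apply: measurable_funM.
  apply: (measurableT_comp l_meas (g := fun p : S * (borel XX * borel YY) =>
    (p.2.2, y' (s j) p.1))).
  apply: measurable_fun_pair; last exact: measurableT_comp (my _)
    measurable_fst.
  exact: measurableT_comp measurable_snd measurable_snd.
pose A := [set p : S * borel XX | voronoi (fun i => c i p.1 : XX) k j p.2].
have mA : measurable A by exact: measurable_voronoi.
have : measurable_fun [set: S * (borel XX * borel YY)]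
    ((\1_A : S * borel XX -> R) \o (fun p : S * (borel XX * borel YY) => (p.1,
      p.2.1))).
  apply: measurableT_comp; first exact: measurable_indic.
  apply: measurable_fun_pair => //.
  exact: measurableT_comp measurable_fst measurable_snd.
apply: eq_measurable_fun => p _ /=; rewrite !indicE; congr (_%:R).
Qed.

Lemma measurable_cell_loss_cst (c : nat -> XX) (y' : nat -> YY) k (s : 'I_k ->
  nat) :
  measurable_fun [set: borel XX * borel YY] (cell_loss c y' s).
Proof.
have := @measurable_cell_loss _ unit (fun i _ => c i) (fun i _ => y' i) k s
  (fun i => measurable_cst _) (fun i => measurable_cst _).
by move=> /measurableT_comp/(_ (measurable_pair1 tt)).
Qed.

Context d (Omega : measurableType d) (P : probability Omega R)
  (X : {RV P >-> borel XX}) (Y : {RV P >-> borel YY}).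

Lemma measurable_loss (f : borel XX -> borel YY) :
  measurable_fun [set: borel XX] f ->
  measurable_fun [set: borel XX * borel YY]
    (fun p : borel XX * borel YY => l p.2 (f p.1)).
Proof.
move=> mf; apply: (measurableT_comp l_meas
  (g := fun p : borel XX * borel YY => (p.2, f p.1))).
apply: measurable_fun_pair => //; exact: measurableT_comp mf measurable_fst.
Qed.

Lemma measurable_comp_XY (f : borel XX * borel YY -> R) :
  measurable_fun [set: borel XX * borel YY] f ->
  measurable_fun [set: Omega] (fun w => (f (X w, Y w))%:E).
Proof.
move=> mf; apply/measurable_EFinP.
by apply: (measurableT_comp mf (g := fun w => (X w, Y w))); exact:
  measurable_fun_pair.
Qed.

(** Conditionally on X = x the cell predictor is a constant, namely the label of the cell of x, and
    [mFr x] minimizes the conditional risk over all constants. *)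
Lemma risk_mFr_le (kappa : R.-pker (borel XX) ~> (borel YY))
    (mFr : {mfun borel XX >-> borel YY})
    (c : nat -> XX) (y' : nat -> YY) k (s : 'I_k -> nat) : (0 < k)%N ->
  regular_conditional_distribution P X Y kappa ->
  (forall x : XX,
    argmin [set: YY] (fun y => \int[kappa x]_z (l z y)%:E)%E (mFr x)) ->
  (\int[P]_w (l (Y w) (mFr (X w)))%:E <=
   \int[P]_w (cell_loss c y' s (X w, Y w))%:E)%E.
Proof.
move=> k0 kappaP mFrP.
have m1 : measurable_fun [set: borel XX * borel YY]
    (fun p : borel XX * borel YY => (l p.2 (mFr p.1))%:E).
  by apply/measurable_EFinP; exact: measurable_loss.
have m2 : measurable_fun [set: borel XX * borel YY]
    (fun p : borel XX * borel YY => (cell_loss c y' s p)%:E).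
  by apply/measurable_EFinP; exact: measurable_cell_loss_cst.
have p1 (p : borel XX * borel YY) : (0 <= (l p.2 (mFr p.1))%:E)%E by rewrite
  lee_fin.
have p2 (p : borel XX * borel YY) : (0 <= (cell_loss c y' s p)%:E)%E.
  by rewrite lee_fin; have /andP[] := cell_loss_itv c y' s p k0.
rewrite (integral_disintegration kappaP m1 p1) (integral_disintegration kappaP
  m2 p2)/=.
apply: ge0_le_integral => //.
- by move=> w _; apply: integral_ge0 => z _; rewrite lee_fin.
- apply: (measurableT_comp (f := fun x => \int[kappa x]_z (l z (mFr x))%:E)%E)
  => //.
  exact: (@measurable_fun_integral_finite_kernel _ _ _ _ _
    (fun p : borel XX * borel YY => (l p.2 (mFr p.1))%:E) kappa p1 m1).
- apply: (measurableT_comp (f := fun x => \int[kappa x]_z (cell_loss c y' s (x,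
  z))%:E)%E) => //.
  exact: (@measurable_fun_integral_finite_kernel _ _ _ _ _
    (fun p : borel XX * borel YY => (cell_loss c y' s p)%:E) kappa p2 m2).
- move=> w _; have [j jk cj] := voronoi_cover c (X w) k0.
  under [leRHS]eq_integral do rewrite (@cell_lossE c y' k s (Ordinal jk))//.
  by have [_] := mFrP (X w); apply.
Qed.

Lemma risk_approximation (c0 alpha : R) (mFr : {mfun borel XX >-> borel YY})
    (e : nat -> XX) (ey : nat -> YY) (c : nat -> XX) (y' : nat -> YY) (eps :
      R) :
  (forall y y' y'', `|l y y' - l y y''| <= c0 * l y' y'') ->
  0 < alpha ->
  (forall y y', l y y' <= `|y - y'| `^ alpha) ->
  (forall x : XX,
     measure_support (distribution P Y : set YY -> \bar R) (mFr x)) ->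
  (forall x (r : R), 0 < r -> exists n, mdist x (e n) < r) ->
  (forall y (r : R), 0 < r -> exists n, `|y - ey n| < r) ->
  (forall i (q : nat), (0 < distribution P X [set x :
    XX | (mdist (e i) x < q.+1%:R^-1)%R])%E ->
    exists j, mdist (e i) (c j) < q.+1%:R^-1) ->
  (forall i (q : nat), (0 < distribution P Y [set y :
    YY | (`|ey i - y| < q.+1%:R^-1)%R])%E ->
    exists j, `|ey i - y' j| < q.+1%:R^-1) ->
  0 < eps ->
  exists N : nat, forall k n : nat, (N <= k)%N -> (N <= n)%N ->
    exists s : 'I_k -> 'I_n,
      (\int[P]_w (cell_loss c y' s (X w, Y w))%:E <=
        \int[P]_w (l (Y w) (mFr (X w)))%:E + eps%:E)%E.
Proof.
move=> l_lip alpha0 l_holder mFr_supp ed eyd hitX hitY eps0.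
have e20 : 0 < eps / 2 by rewrite divr_gt0.
(* The error budget: a loss of at most [t] between the label and [mFr x] on the good set costs eps/2
   after the factor [|c0|]. Two exceptional sets of measure [eps1] cost another eps/2, the loss
   being at most [L]. *)
pose t := eps / 2 / (`|c0| + 1).
have c10 : 0 < `|c0| + 1 by rewrite ltr_wpDl.
have t0 : 0 < t by rewrite divr_gt0.
have ct : `|c0| * t <= eps / 2.
  by rewrite /t mulrCA ler_piMr ?(ltW e20)// ler_pdivrMr// mul1r lerDl.
have L0 : 0 <= L by apply: le_trans (l_bounded 0 0); exact: l_ge0.
pose eps1 := eps / 4 / (L + 1).
have L10 : 0 < L + 1 by rewrite ltr_wpDl.
have eps10 : 0 < eps1 by rewrite !divr_gt0.
have Leps1 : L * (eps1 + eps1) <= eps / 2.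
  have -> : eps1 + eps1 = eps / 2 / (L + 1) by rewrite /eps1; field;
    rewrite lt0r_neq0.
  by rewrite mulrCA ler_piMr ?(ltW e20)// ler_pdivrMr// mul1r lerDl.
(* By the Hoelder bound, points within 2 del of each other have loss at most [t]. Radii have the
   form 1/(q+1) because [hitX] and [hitY] speak of these only. *)
have [q qt] : exists q : nat, q.+1%:R^-1 < (t `^ alpha^-1) / 2.
  by apply: exists_inv_lt; rewrite divr_gt0// powR_gt0.
pose del : R := q.+1%:R^-1; rewrite -/del in qt.
have del0 : 0 < del by rewrite invr_gt0.
have small (u v : YY) : `|u - v| < del + del -> l u v <= t.
  move=> uv; apply: le_trans (l_holder _ _) _.
  have -> : t = (t `^ alpha^-1) `^ alpha.
    by rewrite -powRrM mulVf ?lt0r_neq0// powRr1// ltW.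
  apply: ge0_ler_powR; rewrite ?nnegrE ?powR_ge0 ?(ltW alpha0)//.
  by apply: ltW; apply: (lt_trans uv); lra.
pose b i : set (borel YY) := [set y : YY | `|ey i - y| < del].
have ob i : open (b i : set YY).
  rewrite (_ : b i = ball (ey i) del :> set YY); first exact: ball_open.
  by rewrite -ball_normE.
pose B i : set (borel XX) := mFr @^-1` b i.
have mB i : measurable (B i).
  by rewrite -[B i]setTI; apply: measurable_funP => //; apply:
    sub_sigma_algebra; exact: ob.
have BT : \bigcup_i B i = setT.
  rewrite -subTset => x _; have [i xi] := eyd (mFr x) del del0.
  by exists i => //; rewrite /B/b/= distrC.
have [M [r [E1 [r0 mE1 muE1 E1M E1r]]]] :=
  uniformly_separated_cover (distribution P X) mB BT eps10.
(* Good points of one cell are within 2 rho of its nucleus, hence within 4 rho < r of each other. *)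
have [q' q'r] : exists q : nat, q.+1%:R^-1 < r / 4.
  by apply: exists_inv_lt; rewrite divr_gt0.
pose rho : R := q'.+1%:R^-1; rewrite -/rho in q'r.
have rho0 : 0 < rho by rewrite invr_gt0.
have rho4 : rho + rho + (rho + rho) < r by lra.
have [K [E2 [mE2 muE2 E2K]]] := near_nuclei (mu :=
  distribution P X) ed rho0 eps10
  (fun i => hitX i q').
(* If [B i] is nonempty, the ball [b i] contains a point [mFr x] of the support, so it has positive
   measure and some prototype is near its centre. Empty [B i] get the dummy index 0. *)
have /choice[T HT] : forall i, exists j, forall x, B i x ->
  `|ey i - y' j| < del.
  move=> i; have [[x Bix]|nB] := pselect (exists x, B i x).
    have [|j ij] := hitY i q; last by exists j.
    exact: mFr_supp (ob i) Bix.
  by exists 0%N => x Bix; exfalso; apply: nB; exists x.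
pose N := maxn K.+1 (\max_(i < M) T i).+1.
exists N => k n Nk Nn.
have Kk : (K <= k)%N by apply: leq_trans (leqnSn K) _; exact:
  leq_trans (leq_maxl _ _) Nk.
have n0 : (0 < n)%N by exact: leq_trans (leq_trans (leq_maxr K.+1 _) Nn).
have Tn i : (i < M)%N -> (T i < n)%N.
  move=> iM; apply: (leq_trans _ Nn); apply: (leq_trans _ (leq_maxr _ _)).
  by rewrite ltnS (leq_bigmax (Ordinal iM)).
(* A cell with a good point [x0] is labelled by the prototype of a ball containing [mFr x0]; all its
   other good points are within [r] of [x0], so [mFr] sends them to the same ball. Any label serves
   a cell without good points. *)
have /choice[s Hs] : forall j : 'I_k, exists i : 'I_n, forall x, E1 x -> E2 x ->
    voronoi c k j x -> `|mFr x - y' i| < del + del.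
  move=> j.
  have [[x0 [Ex1 Ex2 cx0]]|nx] := pselect (exists x0, [/\ E1 x0,
    E2 x0 & voronoi c k j x0]).
    have [i iM Bi] := E1M _ Ex1.
    exists (Ordinal (Tn _ iM)) => x E1x E2x cx /=.
    have near x' : E2 x' -> voronoi c k j x' -> mdist (x' :
      XX) (c j) < rho + rho.
      move=> E2x' cx'; have [i' i'K xi'] := E2K _ E2x'.
      exact: le_lt_trans (voronoi_nearest (leq_trans i'K Kk) cx') xi'.
    have Bx : B i x.
      apply: (E1r x0) => //.
      apply: le_lt_trans (metric_triangle (x0 : XX) (c j) x) _.
      by apply: lt_trans rho4; rewrite ltrD ?near// metric_sym near.
    have := HT i x Bx; move: Bx; rewrite /B/b/= => h1 h2.
    rewrite -(subrKA (ey i)) (le_lt_trans (ler_normD _ _))// ltrD//.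
    by rewrite distrC.
  by exists (Ordinal n0) => x E1x E2x cx; exfalso; apply: nx; exists x.
exists s.
have k0 : (0 < k)%N by apply: leq_trans Nk; rewrite leq_max.
pose Ec := ~` E1 `|` ~` E2.
have mEc : measurable Ec by apply: measurableU; exact: measurableC.
have PEc : (distribution P X Ec <= (eps1 + eps1)%:E)%E.
  rewrite (le_trans (measureU2 _ _ _))//; try exact: measurableC.
  by rewrite EFinD leeD.
(* On the exceptional set [Ec] the loss is bounded by [L]; elsewhere the Lipschitz-type condition
   compares the label with [mFr x]. *)
have bound x y : cell_loss c y' s (x, y) <=
    l y (mFr x) + (`|c0| * t + L * \1_Ec x).
  have [j jk cj] := voronoi_cover c x k0.
  rewrite (@cell_lossE c y' k s (Ordinal jk))//.
  have [Ex|nEx] := pselect (Ec x).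
    rewrite indicE mem_set// mulr1 (le_trans (l_bounded _ _))//.
    by rewrite addrA lerDr addr_ge0// mulr_ge0// ltW.
  rewrite indicE memNset// mulr0 addr0 -lerBlDl.
  apply: (le_trans (ler_norm _)); rewrite distrC; apply:
    (le_trans (l_lip _ _ _)).
  apply: (le_trans (ler_wpM2r (l_ge0 _ _) (ler_norm c0))).
  have E1x : E1 x by apply: contrapT => nE; apply: nEx; left.
  have E2x : E2 x by apply: contrapT => nE; apply: nEx; right.
  by rewrite ler_wpM2l//; apply: small; exact: (Hs (Ordinal jk) x E1x E2x cj).
have mX1 : measurable_fun [set: borel XX * borel YY]
    (fun p : borel XX * borel YY => `|c0| * t + L * \1_Ec p.1).
  apply: measurable_funD => //; apply: measurable_funM => //.
  by apply: measurableT_comp; [exact: measurable_indic|exact: measurable_fst].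
have ml : measurable_fun [set: borel XX * borel YY]
    (fun p : borel XX * borel YY => l p.2 (mFr p.1)) by exact: measurable_loss.
have pos (w : Omega) : 0 <= `|c0| * t + L * \1_Ec (X w).
  by rewrite addr_ge0// mulr_ge0// ltW.
apply: (@le_trans _ _ (\int[P]_w ((l (Y w) (mFr (X w)))%:E +
    (`|c0| * t + L * \1_Ec (X w))%:E))%E).
  apply: ge0_le_integral => //.
  - by move=> w _; rewrite lee_fin; have /andP[] := cell_loss_itv c y' s (X w,
    Y w) k0.
  - exact: measurable_comp_XY (measurable_cell_loss_cst _ _ _).
  - apply: emeasurable_funD; first exact: (measurable_comp_XY ml).
    exact: (measurable_comp_XY mX1).
  - by move=> w _; rewrite -EFinD lee_fin bound.
rewrite ge0_integralD//; last 4 first.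
- by move=> w _; rewrite lee_fin.
- exact: (measurable_comp_XY ml).
- by move=> w _; rewrite lee_fin.
- exact: (measurable_comp_XY mX1).
rewrite leeD2l//.
under eq_integral do rewrite EFinD [(L * _)%:E]EFinM.
have mI : measurable_fun [set: Omega] (fun w => (\1_Ec (X w) : R)%:E).
  apply/measurable_EFinP; apply: measurableT_comp => //; exact:
    measurable_indic.
rewrite ge0_integralD//; last 3 first.
- by move=> w _; rewrite lee_fin mulr_ge0// ltW.
- by move=> w _; rewrite -EFinM lee_fin mulr_ge0.
- exact: measurable_funeM.
rewrite integral_probability_cst ge0_integralZl// [in leRHS](splitr eps) EFinD.
apply: leeD; first by rewrite lee_fin.
have -> : (\int[P]_w (\1_Ec (X w) : R)%:E = distribution P X Ec)%E.
  rewrite /distribution/pushforward -[in RHS](setIT (X @^-1` Ec))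
    -integral_indic//.
  by rewrite -[_ @^-1` _]setTI; exact: measurable_funP.
by apply: le_trans (lee_wpmul2l _ PEc) _; rewrite ?lee_fin.
Qed.

End cell_loss.

(** * Estimation error *)

Lemma borel_cantelli_geometric d (Omega : measurableType d) (R : realType)
    (P : probability Omega R) (D : (set Omega)^nat) (q : R) (N : nat) :
  0 <= q < 1 ->
  (forall n, (N <= n)%N -> measurable (D n) /\ (P (D n) <=
    (2 * q ^+ n)%:E)%E) ->
  {ae P, forall w, \forall n \near \oo, ~ D n w}.
Proof.
(* The first [N] events, about which nothing is assumed, are emptied; the probabilities then sum to
   at most 2/(1 - q), and the limsup of the events is unchanged. *)
move=> /andP[q0 q1] HD; pose F n := if (n < N)%N then set0 else D n.
have mF n : measurable (F n).
  by rewrite /F; case: ltnP => // /HD[].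
have PF n : (P (F n) <= (2 * q ^+ n)%:E)%E.
  rewrite /F; case: ltnP => [_|/HD[]//].
  by rewrite measure0 lee_fin mulr_ge0// exprn_ge0.
have sumF : (\sum_(n <oo) P (F n) < +oo)%E.
  apply: (@le_lt_trans _ _ (2 / (1 - q))%:E); last exact: ltry.
  apply: lime_le; first by apply: is_cvg_nneseries => n _ _; exact: measure_ge0.
  apply: nearW => n; apply: (@le_trans _ _ (\sum_(0 <=
    i < n) (2 * q ^+ i)%:E)%E).
    by apply: lee_sum => i _; exact: PF.
  rewrite sumEFin lee_fin.
  have := @geometric_seriesE R 2 q (negbT (lt_eqF q1)).
  move=> /(congr1 (fun u : nat -> R => u n)); rewrite /series/geometric/= => ->.
  rewrite ler_pM2r ?invr_gt0 ?subr_gt0// ler_piMr// lerBlDr lerDl.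
  exact: exprn_ge0.
exists (lim_sup_set F); split.
- by apply: bigcap_measurableType => n _; exact: bigcup_measurable.
- exact: lim_sup_set_cvg0.
move=> w /= Hw n _; apply: contrapT => Fn; apply: Hw.
exists (maxn n N) => // j /=; rewrite geq_max => /andP[nj Nj] Dj; apply: Fn.
by exists j => //; rewrite /F ltnNge Nj.
Qed.

(** The left side is 2 exp(k ln n - K n), and eventually k ln n <= (K/2) n: the number of labellings
    consumes at most half of the exponential rate. *)
Lemma labels_growth (R : realType) (k : nat -> nat) (K : R) :
  (k n)%:R * ln (n%:R : R) / n%:R @[n --> \oo] --> (0 : R) -> 0 < K ->
  \forall n \near \oo, n%:R ^+ k n * (2 * expR (- (K * n%:R))) <=
    2 * expR (- (K / 2)) ^+ n.
Proof.
move=> /cvgrPdist_le ksmall K0; have K20 : 0 < K / 2 by rewrite divr_gt0.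
near=> n; have n0 : (0 < n)%N by near: n; exact: nbhs_infty_gt.
have n0R : 0 < n%:R :> R by rewrite ltr0n.
have : `|0 - (k n)%:R * ln (n%:R : R) / n%:R| <= K / 2 by near: n; exact:
  ksmall.
rewrite sub0r normrN => /(le_trans (ler_norm _)); rewrite ler_pdivrMr// => kn.
have lnn : expR (ln n%:R) = n%:R :> R by rewrite lnK ?posrE.
rewrite -[X in X ^+ k n]lnn -(expRM_natl (k n)) -(expRM_natl n).
rewrite mulrCA -expRD ler_pM2l// ler_expR.
have -> : n%:R * - (K / 2) = K / 2 * n%:R - K * n%:R by field.
by rewrite lerD2r.
Unshelve. all: by end_near. Qed.

(** Here [A] and [B] stand for the empirical sums of the minimizer and of a good competitor, [a] and
    [b] for their risks, and [r0] for the optimal risk. Two deviations and A <= B give a < b + 2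
    del, hence a <= r0 + eps. *)
Lemma erm_deviation (R : realFieldType) (n A B a b r0 del eps : R) :
  0 < n -> A <= B -> `|A - n * a| < n * del -> `|B - n * b| < n * del ->
  r0 <= a -> b <= r0 + eps / 3 -> del < eps / 3 -> `|r0 - a| <= eps.
Proof.
move=> n0 AB; rewrite !ltr_norml => /andP[Aa _] /andP[_ Bb] r0a br0 de.
have : a < b + (del + del).
  by rewrite -(ltr_pM2l n0) !mulrDr; lra.
by rewrite ler_norml; lra.
Qed.

Section uniform_deviation.
Context (R : realType) (XX : pmetricType R) (YY : completeNormedModType R)
  (l : YY -> YY -> R) (L : R).
Hypothesis sepX : separable XX.
Hypothesis l_meas : measurable_fun [set: borel YY * borel YY]
  (fun p : borel YY * borel YY => l p.1 p.2).
Hypothesis l_ge0 : forall y y', 0 <= l y y'.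
Hypothesis l_bounded : forall y y', l y y' <= L.
Context d (Omega : measurableType d) (P : probability Omega R)
  (X : {RV P >-> borel XX}) (Y : {RV P >-> borel YY})
  (Xd X' : nat -> {RV P >-> borel XX}) (Yd Y' : nat -> {RV P >-> borel YY}).

(** Each labelling deviates with probability at most 2 exp(-K n). Finite functions make the
    labellings a finite type with n^(k n) elements, over which the union bound still leaves a
    geometric sequence. *)
Lemma uniform_deviation (k : nat -> nat) (eps : R) :
  iid_copies P (fun i w => (Xd i w, Yd i w)) (fun w => (X w, Y w)) ->
  independent_sequences P
    (fun i w => (X' i w, Y' i w)) (fun i w => (Xd i w, Yd i w)) ->
  (forall n, (0 < n)%N -> (0 < k n)%N) ->
  (k n)%:R * ln (n%:R : R) / n%:R @[n --> \oo] --> (0 : R) ->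
  0 < eps ->
  {ae P, forall w, \forall n \near \oo, forall s : {ffun 'I_(k n) -> 'I_n},
    `|\sum_(i < n) cell_loss l (X' ^~ w) (Y' ^~ w) (fun j => s j) (Xd i w,
      Yd i w) -
      n%:R * fine (\int[P]_w' (cell_loss l (X' ^~ w) (Y' ^~ w) (fun j =>
        s j) (X w', Y w'))%:E)|
    < n%:R * eps}.
Proof.
move=> data_iid indep k_gt0 k_small eps0.
pose T : measurableType _ := (borel XX * borel YY)%type.
pose W : nat -> Omega -> T := fun i w => (X' i w, Y' i w).
pose Z : nat -> Omega -> T := fun i w => (Xd i w, Yd i w).
pose Z0 : Omega -> T := fun w => (X w, Y w).
have mW i : measurable_fun [set: Omega] (W i) by exact: measurable_fun_pair.
have mZ i : measurable_fun [set: Omega] (Z i) by exact: measurable_fun_pair.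
have mZ0 : measurable_fun [set: Omega] Z0 by exact: measurable_fun_pair.
have [K K0 HK] := conditional_hoeffding P T T L eps0.
pose D n (s : {ffun 'I_(k n) -> 'I_n}) : set Omega := [set w | n%:R * eps <=
  `|\sum_(i < n) cell_loss l (X' ^~ w) (Y' ^~ w) (fun j => s j) (Z i w) -
    n%:R * fine (\int[P]_w' (cell_loss l (X' ^~ w) (Y' ^~ w) (fun j =>
      s j) (Z0 w'))%:E)|].
have HD n (s : {ffun 'I_(k n) -> 'I_n}) : (0 < n)%N ->
    measurable (D n s) /\ (P (D n s) <= (2 * expR (- (K * n%:R)))%:E)%E.
  move=> n0.
  apply: (HK W Z Z0 (fun w => cell_loss l (X' ^~ w) (Y' ^~ w) (fun j =>
    s j))) => //.
    (* The random loss depends on the sample point through the prototypes only, so it is measurable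
       for the sigma-algebra they generate. *)
    pose GW := g_sigma_algebraType (sigma_generators W).
    apply: (@measurable_cell_loss _ _ _ _ sepX l_meas _ GW
      (fun i => X' i : GW -> borel XX) (fun i => Y' i : GW -> borel YY)) => i.
      exact: (measurableT_comp measurable_fst (@measurable_sigma_generators _ _
        _ _ W i)).
    exact: (measurableT_comp measurable_snd (@measurable_sigma_generators _ _ _
      _ W i)).
  by move=> w x; apply: cell_loss_itv => //; exact: k_gt0.
pose DD n := \big[setU/set0]_(s : {ffun 'I_(k n) -> 'I_n}) D n s.
have [N _ HN] := labels_growth k_small K0.
have K20 : 0 < K / 2 by rewrite divr_gt0.
have q01 : 0 <= expR (- (K / 2)) < 1.
  by rewrite expR_ge0/= expR_lt1 oppr_lt0.
have HDD n : (maxn N 1 <= n)%N ->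
    measurable (DD n) /\ (P (DD n) <= (2 * expR (- (K / 2)) ^+ n)%:E)%E.
  rewrite geq_max => /andP[Nn n0].
  have mDn s : measurable (D n s) by have [] := HD n s n0.
  split; first exact: bigsetU_measurable.
  apply: le_trans (_ : _ <= (n%:R ^+ k n * (2 * expR (- (K * n%:R))))%:E)%E _.
    apply: (@le_trans _ _ (\sum_(s : {ffun 'I_(k n) -> 'I_n}) P (D n s))%E).
      rewrite /DD; elim: (index_enum _) => [|s r IH];
        first by rewrite !big_nil measure0.
      rewrite !big_cons (le_trans (measureU2 _ _ _))//; first exact:
        bigsetU_measurable.
      by rewrite leeD2l.
    apply: (@le_trans _ _ (\sum_(s : {ffun 'I_(k n) ->
      'I_n}) (2 * expR (- (K * n%:R)))%:E)%E).
      by apply: lee_sum => s _; have [] := HD n s n0.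
    by rewrite sumEFin lee_fin sumr_const card_ffun !card_ord -[leLHS]mulr_natl
      natrX.
  by rewrite lee_fin; exact: HN.
apply: filterS (borel_cantelli_geometric q01 HDD) => w; apply: filterS =>
  n DDn s.
rewrite ltNge; apply/negP => Ds; apply: DDn.
by rewrite /DD (bigD1 s)//=; left.
Qed.

End uniform_deviation.

(** * Almost sure consistency from the estimation and approximation bounds *)

Theorem theorem2 (R : realType)
    (XX : pmetricType R) (YY : completeNormedModType R)
    (sepX : separable XX) (sepY : separable YY)
    (d : measure_display) (Omega : measurableType d) (P : probability Omega R)
    (* the random pair (X, Y) *)
    (X : {RV P >-> borel XX}) (Y : {RV P >-> borel YY})
    (* the loss function *)
    (l : YY -> YY -> R) (L c alpha : R)
    (l_meas : measurable_fun [set: borel YY * borel YY]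
       (fun p : borel YY * borel YY => l p.1 p.2))
    (l_ge0 : forall y y', 0 <= l y y')
    (l_bounded : forall y y', l y y' <= L)
    (l_lip : forall y y' y'', `|l y y' - l y y''| <= c * l y' y'')
    (alpha_gt0 : 0 < alpha)
    (l_holder : forall y y', l y y' <= `|y - y'| `^ alpha)
    (* the conditional Frechet mean *)
    (kappa : R.-pker (borel XX) ~> (borel YY))
    (kappaP : regular_conditional_distribution P X Y kappa)
    (mFr : {mfun borel XX >-> borel YY})
    (mFr_argmin : forall x : XX,
       argmin [set: YY] (fun y => \int[kappa x]_z (l z y)%:E)%E (mFr x))
    (mFr_support : forall x : XX,
       measure_support (distribution P Y : set YY -> \bar R) (mFr x))
    (* the data ((Xd i, Yd i))_i and the prototypes (X' i)_i, (Y' i)_i *)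
    (Xd X' : nat -> {RV P >-> borel XX}) (Yd Y' : nat -> {RV P >-> borel YY})
    (data_iid : iid_copies P (fun i w => (Xd i w, Yd i w))
       (fun w => (X w, Y w)))
    (X'_iid : iid_copies P (fun i w => X' i w) X)
    (Y'_iid : iid_copies P (fun i w => Y' i w) Y)
    (proto_indep : independent_sequences P
       (fun i w => (X' i w, Y' i w)) (fun i w => (Xd i w, Yd i w)))
    (* no ties; the first coordinate of Omega * Omega carries a version of X
       that is independent of the prototypes *)
    (no_ties : forall i j : nat, i != j ->
       (P \x P)%E [set p : Omega * Omega |
         mdist (X p.1 : XX) (X' i p.2) = mdist (X p.1 : XX) (X' j p.2)] = 0%E)
    (k : nat -> nat)
    (k_gt0 : forall n, (0 < n)%N -> (0 < k n)%N)
    (k_oo : k n @[n --> \oo] --> \oo)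
    (k_small : (k n)%:R * ln (n%:R : R) / n%:R @[n --> \oo] --> (0 : R))
    (* the estimators *)
    (m : nat -> Omega -> XX -> YY)
    (m_meas : forall n, (0 < n)%N ->
       measurable_fun [set: Omega * borel XX]
         (fun p : Omega * borel XX => m n p.1 p.2 : borel YY))
    (m_argmin : forall n, (0 < n)%N -> forall (w : Omega) (j : nat),
       (j < k n)%N ->
       let A : set XX := voronoi (fun i => X' i w : XX) (k n) j in
       exists2 y : YY,
         argmin [set (Y' i w : YY) | i in `I_n]
           (fun y => \sum_(i < n) l (Yd i w) y * \1_A (Xd i w)) y &
         forall x, A x -> m n w x = y) :
  {ae P, forall w : Omega,
    risk P X Y l (m n w) @[n --> \oo] --> risk P X Y l mFr}.

Proof.
have [e ed] := separable_mdist sepX.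
have [ey eyd] : exists ey : nat -> YY,
    forall y (r : R), 0 < r -> exists n, `|y - ey n| < r.
  have [ey eyd] := separable_dense_seq (0 : YY) sepY.
  by exists ey => y r /(eyd y)[n]; rewrite -ball_normE; exists n.
(* Only countably many centres and radii are involved, so a single null set serves for all balls;
   likewise for [hitY], and for the tolerances 1/(p+1) in [dev]. *)
have hitX : {ae P, forall w, forall i q : nat,
    (0 < distribution P X [set x : XX | (mdist (e i) x < q.+1%:R^-1)%R])%E ->
    exists j, mdist (e i) (X' j w : XX) < q.+1%:R^-1}.
  apply: ae_foralln => i; apply: ae_foralln => q.
  set B := [set x : XX | _].
  have [B0|B0] := pselect (0 < distribution P X B)%E; last by apply: aeW =>
    w /B0.
  have mB : measurable (B : set (borel XX)).
    by apply: sub_sigma_algebra; exact: open_mdist_lt.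
  have := @independent_hit _ _ _ P _ _ (fun i w => X' i w) X B
    (fun i => measurable_funP (X' i)) (measurable_funP X) X'_iid mB B0.
  by apply: filterS => w [j Bj] _; exists j.
have hitY : {ae P, forall w, forall i q : nat,
    (0 < distribution P Y [set y : YY | (`|ey i - y| < q.+1%:R^-1)%R])%E ->
    exists j, `|ey i - (Y' j w : YY)| < q.+1%:R^-1}.
  apply: ae_foralln => i; apply: ae_foralln => q.
  set B := [set y : YY | _].
  have [B0|B0] := pselect (0 < distribution P Y B)%E; last by apply: aeW =>
    w /B0.
  have mB : measurable (B : set (borel YY)).
    apply: sub_sigma_algebra.
    rewrite (_ : B = ball (ey i) q.+1%:R^-1); first exact: ball_open.
    by rewrite -ball_normE.
  have := @independent_hit _ _ _ P _ _ (fun i w => Y' i w) Y B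
    (fun i => measurable_funP (Y' i)) (measurable_funP Y) Y'_iid mB B0.
  by apply: filterS => w [j Bj] _; exists j.
have dev : {ae P, forall w, forall p : nat, \forall n \near \oo,
    forall s : {ffun 'I_(k n) -> 'I_n},
    `|\sum_(i < n) cell_loss l (X' ^~ w) (Y' ^~ w) (fun j => s j) (Xd i w,
      Yd i w) -
      n%:R * fine (\int[P]_w' (cell_loss l (X' ^~ w) (Y' ^~ w) (fun j =>
        s j) (X w', Y w'))%:E)|
    < n%:R * p.+1%:R^-1}.
  apply: ae_foralln => p.
  apply: (uniform_deviation sepX l_meas l_ge0 l_bounded data_iid proto_indep) =>
    //.
(* The sample point is now fixed, and the rest is deterministic. *)
apply: filterS3 hitX hitY dev => w HX HY Hdev.
have riskE (f : XX -> YY) : risk P X Y l f = (\int[P]_w' (l (Y w') (f (X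
  w')))%:E)%E.
  by rewrite /risk unlock.
pose CL n (s : 'I_(k n) -> 'I_n) := cell_loss l (X' ^~ w) (Y' ^~ w) (fun j =>
  s j).
have finR n s : (0 < n)%N -> (\int[P]_w' (@CL n s (X w',
  Y w'))%:E)%E \is a fin_num.
  move=> n0; apply: integrable_fin_num => //.
  apply: (@bounded_measurable_integrable _ _ _ P (fun w' => CL n s (X w',
    Y w')) L).
    apply/measurable_EFinP; apply: measurable_comp_XY.
    exact: (measurable_cell_loss_cst sepX l_meas).
  move=> w'; have /andP[a b] := cell_loss_itv l_ge0 l_bounded (X' ^~ w) (Y' ^~
    w)
    s (X w', Y w') (k_gt0 _ n0).
  by rewrite ger0_norm.
have fin0 : (\int[P]_w' (l (Y w') (mFr (X w')))%:E)%E \is a fin_num.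
  apply: integrable_fin_num => //.
  apply: (@bounded_measurable_integrable _ _ _ P (fun w' =>
    l (Y w') (mFr (X w'))) L).
    apply/measurable_EFinP.
    exact: (measurable_comp_XY X Y (measurable_loss l_meas (measurable_funP
      mFr))).
  by move=> w'; rewrite ger0_norm.
(* The empirical risk is a sum over the cells, so the choice of a best label in each cell separately
   minimizes it over all labellings at once. *)
have erm n : (0 < n)%N -> exists s : 'I_(k n) -> 'I_n,
    risk P X Y l (m n w) = (\int[P]_w' (CL n s (X w', Y w'))%:E)%E /\
    forall s', \sum_(i < n) CL n s (Xd i w, Yd i w) <=
               \sum_(i < n) CL n s' (Xd i w, Yd i w).
  move=> n0.
  have /choice[s Hs] : forall j : 'I_(k n), exists i : 'I_n,
      (forall x, voronoi (X' ^~ w : nat -> XX) (k n) j x -> m n w x = Y' i w) /\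
      forall i' : 'I_n, \sum_(i0 < n) l (Yd i0 w) (Y' i w) *
          \1_(voronoi (X' ^~ w : nat -> XX) (k n) j) (Xd i0 w) <=
        \sum_(i0 < n) l (Yd i0 w) (Y' i' w) *
          \1_(voronoi (X' ^~ w : nat -> XX) (k n) j) (Xd i0 w).
    move=> j; have [y [[i /= iN <-] ymin] yA] := m_argmin n n0 w j (ltn_ord j).
    by exists (Ordinal iN); split=> [|i']; [exact: yA|apply: ymin; exists i'].
  exists s; split.
    rewrite riskE; apply: eq_integral => w' _; congr EFin.
    have [j jk cj] := voronoi_cover (X' ^~ w : nat -> XX) (X w') (k_gt0 _ n0).
    have [h _] := Hs (Ordinal jk).
    by rewrite (h _ cj) /CL (@cell_lossE _ _ _ l _ _ _ _ (Ordinal jk) _ _ cj).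
  move=> s'; rewrite /CL /cell_loss exchange_big [leRHS]exchange_big/=.
  by apply: ler_sum => j _; have [_] := Hs j; apply.
rewrite [X in _ --> X]riskE -(fineK fin0); apply/fine_cvgP; split.
  near=> n; have n0 : (0 < n)%N by near: n; exact: nbhs_infty_gt.
  by have [s [-> _]] := erm n n0; exact: finR.
apply/cvgrPdist_le => eps eps0; have e30 : 0 < eps / 3 by rewrite divr_gt0.
have [p pe] := exists_inv_lt e30.
have [N HN] := risk_approximation sepX l_meas l_ge0 l_bounded l_lip alpha_gt0
  l_holder
  mFr_support ed eyd HX HY e30.
near=> n; have n0 : (0 < n)%N by near: n; exact: nbhs_infty_gt.
have Nn : (N <= n)%N by near: n; exact: nbhs_infty_ge.
have Nk : (N <= k n)%N by near: n; exact: (k_oo _ (nbhs_infty_ge N)).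
have [s [sE smin]] := erm n n0.
have [s0 Hs0] := HN (k n) n Nk Nn.
have devn (u : 'I_(k n) -> 'I_n) :
    `|\sum_(i < n) CL n u (Xd i w, Yd i w) -
      n%:R * fine (\int[P]_w' (CL n u (X w', Y w'))%:E)%E| < n%:R * p.+1%:R^-1.
  have -> : CL n u = CL n [ffun j => u j].
    by congr cell_loss; apply/funext => j; rewrite ffunE.
  by move: [ffun j => u j]; near: n; exact: (Hdev p).
(* The competitor of the minimizer [s] is the labelling [s0] from the approximation bound; each
   deviation is below eps/3, and [s0] is within eps/3 of the optimal risk. *)
rewrite /= sE; apply: (erm_deviation _ (smin s0) (devn s) (devn s0) _ _ pe).
- by rewrite ltr0n.
- rewrite -lee_fin !fineK//; last exact: finR.
  exact: (risk_mFr_le sepX l_meas l_ge0 l_bounded _ _ _ (k_gt0 _ n0) kappaP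
    mFr_argmin).
- by rewrite -lee_fin EFinD !fineK//; exact: finR.
Unshelve. all: by end_near. Qed.
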